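(* Let $\varphi\in L^2(\mathbb{R}^+)$, $\psi\in L^2(\mathbb{R})$, let $J\subseteq\mathbb{N}$, and let $\{g_n\}_{n\in J}$ be an orthonormal sequence (or a Riesz sequence) of functions in $L^2(\mathbb{R}^+)$ such that, for all $n\in J$ and for almost every $x\in\mathbb{R}^+$, $\omega\in\mathbb{R}$, $$|g_n(x)|\le|\varphi(x)|,\qquad|\mathcal{M}g_n(\omega)|\le|\psi(\omega)|.$$ Then the sequence $\{g_n\}_{n\in J}$ must be finite (that is, $J$ is finite).
   Context: Functions are complex-valued. $\mathbb{R}^+=(0,+\infty)$ and $L^2(\mathbb{R}^+)=L^2(\mathbb{R}^+,r^{-1}dr)$ is the space of measurable functions on $\mathbb{R}^+$ that are square integrable with respect to the Haar measure $r^{-1}dr$. The Mellin transform is $$\mathcal{M}f(\omega)=\int_0^{+\infty}f(r)r^{-2\pi i\omega}\,\frac{dr}{r},\qquad\omega\in\mathbb{R},$$ understood on $L^2(\mathbb{R}^+)$ in the Plancherel sense, i.e. $\mathcal{M}f$ is the ($L^2$, unitary) Fourier transform, with kernel $e^{-2\pi i\omega x}$, of the function $x\mapsto f(e^x)\in L^2(\mathbb{R})$. A sequence $\{u_n\}_{n\in J}$ in a Hilbert space $H$ (here $H=L^2(\mathbb{R}^+)$) is a Riesz sequence if there is an invertible bounded linear operator $U:H\to H$ with bounded inverse such that $\{U(u_n)\}_{n\in J}$ is an orthonormal sequence in $H$. *)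

(* Defs.v *)
From HB Require Import structures.
From mathcomp Require Import all_boot all_order all_algebra.
From mathcomp Require Import all_classical all_reals all_analysis.
From mathcomp Require Import measurable_realfun complex.

Set Implicit Arguments.
Unset Strict Implicit.
Unset Printing Implicit Defensive.
Import Order.TTheory GRing.Theory Num.Theory.
Import numFieldNormedType.Exports.

Local Open Scope classical_set_scope.
Local Open Scope ring_scope.
Local Open Scope complex_scope.

(* Elements of L^p(D, mu) are represented by functions on T whose values outside
   D are irrelevant; equality of classes is [ae_eq mu D]. *)
Section complex_L2.
Context d (T : measurableType d) (R : realType).
Variables (mu : {measure set T -> \bar R}) (D : set T).
Implicit Types (f g : T -> R[i]) (p : R).

Definition cmeasurable_fun f :=
  measurable_fun D (fun x => complex.Re (f x)) /\
  measurable_fun D (fun x => complex.Im (f x)).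

Definition cintegral f : R[i] :=
  (\int[mu]_(x in D) complex.Re (f x)) +i* (\int[mu]_(x in D) complex.Im (f x)).

(* [complex.Re `|z|] is the modulus of z as an element of R: in R[i] the norm
   is valued in R[i] itself. *)
Definition cLnorm p f : \bar R :=
  'N[mu]_(p%:E)[(fun x => (complex.Re `|f x|)%:E) \_ D].

Definition cLfun p f := cmeasurable_fun f /\ (cLnorm p f < +oo)%E.

Definition L2inner f g : R[i] := cintegral (fun x => f x * (g x)^*).

Definition orthonormal_seq (J : set nat) (u : nat -> T -> R[i]) :=
  (forall n, J n -> cLfun 2 (u n)) /\
  (forall n m, J n -> J m -> L2inner (u n) (u m) = (n == m)%:R).

(* An operator on classes of functions is represented by a map on
   representatives; linearity and boundedness make it compatible with almost
   everywhere equality. *)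
Definition bounded_linear_L2 (U : (T -> R[i]) -> (T -> R[i])) :=
  [/\ forall f, cLfun 2 f -> cLfun 2 (U f),
      forall (a : R[i]) f g, cLfun 2 f -> cLfun 2 g ->
        ae_eq mu D (U (fun x => a * f x + g x)) (fun x => a * U f x + U g x) &
      exists M : R, forall f, cLfun 2 f ->
        (cLnorm 2 (U f) <= M%:E * cLnorm 2 f)%E].

Definition Riesz_seq (J : set nat) (u : nat -> T -> R[i]) :=
  (forall n, J n -> cLfun 2 (u n)) /\
  exists U V : (T -> R[i]) -> (T -> R[i]),
    [/\ bounded_linear_L2 U, bounded_linear_L2 V,
        forall f, cLfun 2 f -> ae_eq mu D (V (U f)) f,
        forall f, cLfun 2 f -> ae_eq mu D (U (V f)) f &
        orthonormal_seq J (fun n => U (u n))].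

End complex_L2.

Section haar.
Variable R : realType.

Definition Rpos : set R := `]0, +oo[.

(* The Haar measure dr/r of the multiplicative group of positive reals,
   extended by 0 to a measure on R. *)
Definition haar (A : set R) : \bar R :=
  (\int[@lebesgue_measure R]_(r in A `&` Rpos) (r^-1)%:E)%E.

Let haar0 : haar set0 = 0%E.
Proof. by rewrite /haar set0I integral_set0. Qed.

Let haar_ge0 A : (0 <= haar A)%E.
Proof.
apply: integral_ge0 => r [_]; rewrite /Rpos /= in_itv /= andbT => r0.
by rewrite lee_fin invr_ge0 ltW.
Qed.

Let haar_sigma_additive : semi_sigma_additive haar.
Proof.
move=> F mF tF mUF; rewrite /haar setI_bigcupl.
have pos r : Rpos r -> (0 <= (r^-1)%:E)%E.
  by rewrite /Rpos /= in_itv /= andbT => r0; rewrite lee_fin invr_ge0 ltW.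
have mFP k : measurable (F k `&` Rpos).
  by apply: measurableI => //; exact: measurable_itv.
rewrite ge0_integral_bigcup //=.
- by apply: is_cvg_ereal_nneg_natsum_cond => n _ _; apply: integral_ge0 => r [_ /pos].
- apply/measurable_EFinP; rewrite -setI_bigcupl.
  apply: (@measurable_funS _ _ _ _ Rpos); [exact: measurable_itv|exact: subIsetr|].
  apply: open_continuous_measurable_fun; first exact: interval_open.
  move=> r; rewrite inE /Rpos /= in_itv /= andbT => r0.
  by apply: inv_continuous; rewrite gt_eqF.
- by move=> r [k _ [_ /pos]].
- exact: trivIset_setIr.
Qed.

HB.instance Definition _ := isMeasure.Build _ _ _
  haar haar0 haar_ge0 haar_sigma_additive.

End haar.

Arguments Rpos {R}.

Section mellin.
Variable R : realType.
Local Notation leb := (@lebesgue_measure R).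
Implicit Types (f F : R -> R[i]).

Definition expi (t : R) : R[i] := cos t +i* sin t.

Definition fourier_integral f (w : R) : R[i] :=
  cintegral leb setT (fun x => f x * expi (- (2 * pi * w * x))).

(* F represents the image of f under the continuous extension to L^2 of the
   Fourier integral on the intersection of L^1 and L^2. *)
Definition is_fourier_L2 f F :=
  cLfun leb setT 2 F /\
  forall h : nat -> R -> R[i],
    (forall k, cLfun leb setT 1 (h k) /\ cLfun leb setT 2 (h k)) ->
    cLnorm leb setT 2 (fun x => h k x - f x) @[k --> \oo] --> 0%E ->
    cLnorm leb setT 2 (fun w => fourier_integral (h k) w - F w)
      @[k --> \oo] --> 0%E.

(* By the Plancherel theorem a representative exists for every f in L^2 and is
   unique up to almost everywhere equality; one of them is chosen. *)
Definition fourier_L2 f : R -> R[i] :=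
  xget (fun=> 0) [set F | is_fourier_L2 f F].

Definition mellin f : R -> R[i] := fourier_L2 (fun x => f (expR x)).

End mellin.

(* Main.v *)
Require Import Defs.
From mathcomp Require Import all_boot all_order all_algebra.
From mathcomp Require Import all_classical all_reals all_analysis.
From mathcomp Require Import measurable_realfun complex.
From mathcomp Require Import ring lra.

(** The substitution r = e^x carries the Haar measure dr/r to Lebesgue measure,
so that the statement becomes Shapiro's umbrella theorem on the line: a Riesz
sequence f_n of L2(R) with |f_n| <= |phi| and |F_n| <= |psi|, where F_n is the
Fourier transform of f_n, is finite.  (An orthonormal sequence is a Riesz
sequence, with the identity as operator.)

The reason is that the phase plane has finitely many degrees of freedom in a
bounded window.  Since phi and psi control all tails at once, there are N and W
such that, for every n, the transform h_n^ of the truncation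
h_n = f_n 1_[-N,N] keeps at least a fixed amount delta > 0 of its energy in
[-W,W] (lemma [concentration]).  On the other hand h_n^(w) is, for each w, the
inner product of f_n with a wave restricted to [-N,N], of squared norm 2N, so
that the Bessel inequality of Riesz sequences bounds the sum over n of
|h_n^(w)|^2 by a constant multiple of 2N (lemma [truncated_bessel]).
Integrating over [-W,W] bounds the number of indices by a constant multiple of
N W / delta (lemma [umbrella_theorem]).

The Fourier transform enters through two facts, both proved here: on
L1 and L2 it changes the L2 norm by bounded factors in both directions
([cnorm2_fourier_le], [cnorm2_fourier_ge]), and it extends to L2
([fourier_L2_ex]), so that the transform chosen in [fourier_L2] does have the
defining property.  For the first fact, the transforms of the indicators of two
intervals are explicit; their product is a combination of functions
(1 - cos(t w)) / w^2, whose integral is |t| kappa by scaling, and the same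
combination of the numbers |t| is twice the length of the overlap of the
intervals.  Hence the energy of the transform of a step function is exactly
kappa / pi times that of the function ([plancherel_stepf]).  Step functions are
dense for the L1 and L2 norms simultaneously ([step_approx_L1L2]); Fatou's
lemma gives the upper bound for every function of L1 and L2, and the upper
bound applied to the difference between a function and a step function gives
the lower one.  The second fact then follows from the completeness of L2
([L2_complete]), applied to the transforms of the truncations. *)

Set Implicit Arguments.
Unset Strict Implicit.
Unset Printing Implicit Defensive.
Import Order.TTheory GRing.Theory Num.Theory.
Import numFieldNormedType.Exports.
Local Open Scope classical_set_scope.
Local Open Scope ring_scope.

(** * The integral of (1 - cos(t w)) / w^2 *)

Section trigonometric_kernel.
Context {R : realType}.
Local Notation leb := (@lebesgue_measure R).
Implicit Types (t w x : R).

Lemma inv_measurable (D : set R) : measurable_fun D (@GRing.inv R).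
Proof.
apply: (@measurable_funS _ _ _ _ setT) => //.
rewrite -(setUv [set 0 : R]).
apply/measurable_funU => //; first exact: measurableC.
split; first exact: measurable_fun_set1.
apply: open_continuous_measurable_fun.
  by rewrite openC; exact: closed_eq.
by move=> x; rewrite inE /= => /eqP x0; exact: inv_continuous.
Qed.

Lemma normr_sin_le x : `|sin x| <= `|x|.
Proof.
wlog x0 : x / 0 <= x.
  move=> H; have [/H//|/ltW x0] := leP 0 x.
  by rewrite -(opprK x) sinN normrN (normrN (- x)) H// oppr_ge0.
have d y : y \in `]0, x[ -> is_derive y 1 sin (cos y).
  by move=> _; exact: is_derive_sin.
have cs : {within `[0, x], continuous sin}.
  by apply: continuous_subspaceT => y; exact: continuous_sin.
have [c _] := MVT_segment x0 d cs; rewrite sin0 !subr0 => ->; rewrite normrM ler_piMl// cos_max//.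
Qed.

Lemma onem_cos_le x : 1 - cos x <= x ^+ 2 / 2.
Proof.
have -> : 1 - cos x = 2 * sin (x / 2) ^+ 2.
  have e : x / 2 *+ 2 = x by rewrite -mulr_natr divfK.
  have := cos_mulr2n (x / 2); rewrite e => ->.
  by rewrite sin2cos2; ring.
have : sin (x / 2) ^+ 2 <= (x / 2) ^+ 2.
  by rewrite -[leLHS]real_normK ?num_real// -[leRHS]real_normK ?num_real// lerXn2r ?nnegrE//
    normr_sin_le.
lra.
Qed.

(** The frequency-side kernel of the indicators of intervals; its value at 0 is 0. *)
Definition kern t w : R := (1 - cos (t * w)) / w ^+ 2.

Lemma kern_ge0 t w : 0 <= kern t w.
Proof. by rewrite divr_ge0 ?sqr_ge0// subr_ge0 cos_le1. Qed.

Lemma kern_measurable t : measurable_fun setT (kern t).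
Proof.
apply: measurable_funM.
  apply: continuous_measurable_fun => x; apply: cvgB; first exact: cvg_cst.
  apply: continuous_comp; last exact: continuous_cos.
  by apply: cvgM; [exact: cvg_cst|exact: cvg_id].
apply: measurableT_comp; first exact: inv_measurable.
exact: exprn_measurable.
Qed.

Lemma kern0 w : kern 0 w = 0.
Proof. by rewrite /kern mul0r cos0 subrr mul0r. Qed.

Lemma kernZ t w : kern t w = t ^+ 2 * kern 1 (t * w).
Proof.
have [->|t0] := eqVneq t 0; first by rewrite kern0 expr0n mul0r.
have [->|w0] := eqVneq w 0; first by rewrite /kern !(mulr0, expr0n)/= invr0 !mulr0.
by rewrite /kern mul1r; field; rewrite w0 t0.
Qed.

(** The kernel is at most 1/2 near 0 and at most 2 / w^2 far away; both are
absorbed by a multiple of the integrable function 1 / (1 + w^2). *)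
Lemma kern1_le w : kern 1 w <= 5 / 2 * (oneDsqr w)^-1.
Proof.
have o0 : 0 < oneDsqr w by rewrite (lt_le_trans _ (oneDsqr_ge1 _)).
rewrite /kern mul1r ler_pdivlMr//.
have [->|w0] := eqVneq w 0; first by rewrite expr0n invr0 mulr0 mul0r; lra.
rewrite mulrAC ler_pdivrMr ?exprn_even_gt0// /oneDsqr mulrDr mulr1.
have := onem_cos_le w; have := cos_geN1 w; have := sqr_ge0 w.
nra.
Qed.

Lemma integral_oneDsqrV : (\int[leb]_x (oneDsqr x)^-1%:E = pi%:E)%E.
Proof.
rewrite (@ge0_symfun_integralT _ (fun x => (oneDsqr x)^-1)).
- by rewrite -set_itvcy integral0y_oneDsqr -EFinM; congr EFin; field.
- by move=> x; rewrite invr_ge0 (le_trans _ (oneDsqr_ge1 _)).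
- exact: continuous_oneDsqrV.
- by move=> x /=; rewrite /oneDsqr sqrrN.
Qed.

Lemma oneDsqrV_measurable : measurable_fun setT (fun x : R => (oneDsqr x)^-1).
Proof. by apply: continuous_measurable_fun; exact: continuous_oneDsqrV. Qed.

Lemma kern1_integrable : leb.-integrable setT (EFin \o kern 1).
Proof.
apply/integrableP; split; first by apply/measurable_EFinP; exact: kern_measurable.
apply: (@le_lt_trans _ _ (\int[leb]_x ((5 / 2)%:E * (oneDsqr x)^-1%:E))%E).
  apply: ge0_le_integral => //.
  - by apply/measurableT_comp => //; apply/measurable_EFinP; exact: kern_measurable.
  - apply/measurable_EFinP; apply: measurable_funM => //.
    exact: oneDsqrV_measurable.
  - move=> x _ /=; rewrite ger0_norm ?kern_ge0// -EFinM lee_fin.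
    exact: kern1_le.
rewrite ge0_integralZl//.
- by rewrite integral_oneDsqrV -EFinM ltry.
- by apply/measurable_EFinP; exact: oneDsqrV_measurable.
Qed.

Definition kappa : R := \int[leb]_w kern 1 w.

Lemma kappaE : (\int[leb]_w (kern 1 w)%:E = kappa%:E)%E.
Proof. by rewrite /kappa fineK//; exact: integrable_fin_num kern1_integrable. Qed.

(** On [pi/2, pi] the cosine is nonpositive, so the kernel is at least 1 / pi^2. *)
Lemma kappa_gt0 : 0 < kappa.
Proof.
rewrite -lte_fin -kappaE.
pose I : set R := `[pi / 2, pi]%classic.
apply: (@lt_le_trans _ _ (\int[leb]_(w in I) (pi ^- 2)%:E)%E).
  rewrite /I integral_cst//= lebesgue_measure_itv/= lte_fin.
  have pi2 : pi / 2 < pi :> R by rewrite ltr_pdivrMr// ltr_pMr ?pi_gt0// ltr1n.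
  rewrite pi2 -EFinD -EFinM lte_fin mulr_gt0// ?subr_gt0//.
  by rewrite invr_gt0 exprn_gt0// pi_gt0.
apply: (@le_trans _ _ (\int[leb]_(w in I) (kern 1 w)%:E)%E).
  have mI : measurable I by exact: measurable_itv.
  apply: ge0_le_integral => //.
  - by move=> x _; rewrite lee_fin invr_ge0 sqr_ge0.
  - by apply/measurable_EFinP; apply: measurable_funTS; exact: kern_measurable.
  move=> x; rewrite /I/= in_itv/= => /andP[px xp]; rewrite lee_fin /kern mul1r.
  have x0 : 0 < x by rewrite (lt_le_trans _ px)// divr_gt0// pi_gt0.
  rewrite -[leLHS]mul1r ler_pM ?invr_ge0 ?sqr_ge0//.
    rewrite lerBrDl gerDr -oppr_ge0.
    have -> : - cos x = sin (x - pi / 2).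
      by rewrite sinB cos_pihalf sin_pihalf; ring.
    by apply: sin_ge0_pi; have := pi_gt0 R; lra.
  rewrite lef_pV2 ?posrE ?exprn_gt0 ?pi_gt0//.
  by rewrite lerXn2r// nnegrE ltW// pi_gt0.
apply: ge0_subset_integral => //; first exact: measurable_itv.
- by apply/measurable_EFinP; exact: kern_measurable.
- by move=> x _; rewrite lee_fin kern_ge0.
Qed.

(** Lebesgue measure is |a| times its image under multiplication by [a], which
needs to be checked on half-open intervals only. *)
Lemma ge0_integral_scale (f : R -> \bar R) (a : R) : a != 0 ->
  measurable_fun setT f -> (forall x, 0 <= f x)%E ->
  (\int[leb]_x f x = `|a|%:E * \int[leb]_x f (a * x)%R)%E.
Proof.
move=> a0 mf f0.
have an0 : 0 <= `|a| by [].
have ma : measurable_fun setT (fun x : R => (a * x : measurableTypeR R)).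
  by apply: measurable_funM => //; exact: measurable_cst.
rewrite (@eq_measure_integral _ _ _ _ (mscale (NngNum an0)
    (pushforward leb (fun x : R => (a * x : measurableTypeR R))))); last first.
  move=> A mA _; apply: lebesgue_measure_unique => // _ [[x y]] _ <-.
  rewrite /= /mscale /= /pushforward.
  have [a_gt0|a_lt0|/eqP] := ltgtP 0 a; last by rewrite eq_sym (negbTE a0).
  - have -> : (fun x0 : R => a * x0) @^-1` `]x, y]%classic = `]x / a, y / a]%classic.
      apply/seteqP; split => z /=;
        by rewrite !in_itv/= ltr_pdivrMr// ler_pdivlMr// mulrC.
    rewrite !lebesgue_measure_itv/= !lte_fin ltr_pM2r ?invr_gt0//.
    case: ifPn => _; last by rewrite mule0.
    by rewrite gtr0_norm// -!EFinD -EFinM; congr EFin; field.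
  - have -> : (fun x0 : R => a * x0) @^-1` `]x, y]%classic = `[y / a, x / a[%classic.
      apply/seteqP; split => z /=;
        by rewrite !in_itv/= ler_ndivrMr// ltr_ndivlMr// andbC mulrC.
    rewrite !lebesgue_measure_itv/= !lte_fin ltr_nM2r ?invr_lt0//.
    case: ifPn => _; last by rewrite mule0.
    by rewrite ltr0_norm// -!EFinD -EFinM; congr EFin; field.
rewrite ge0_integral_mscale//.
by rewrite ge0_integral_pushforward.
Qed.

(** The substitution w -> t w turns the kernel of parameter t into that of
parameter 1. *)
Lemma integral_kern t : (\int[leb]_w (kern t w)%:E = (`|t| * kappa)%:E)%E.
Proof.
have [->|t0] := eqVneq t 0.
  under eq_integral do rewrite kern0.
  by rewrite integral0 normr0 mul0r.
have m1 : measurable_fun setT (fun w => (kern 1 w)%:E).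
  by apply/measurable_EFinP; exact: kern_measurable.
have := ge0_integral_scale t0 m1; rewrite kappaE => H.
under eq_integral do rewrite kernZ EFinM.
rewrite ge0_integralZl//; last 3 first.
- apply/measurable_EFinP; apply: measurableT_comp (kern_measurable 1) _.
  by apply: measurable_funM.
- by move=> x _; rewrite lee_fin kern_ge0.
- by rewrite lee_fin sqr_ge0.
have k0 w : (0 <= (kern 1 w)%:E)%E by rewrite lee_fin kern_ge0.
rewrite [in RHS]EFinM (H k0) muleA -EFinM.
by rewrite -expr2 real_normK ?num_real.
Qed.

Lemma kern_integrable t : leb.-integrable setT (EFin \o kern t).
Proof.
apply/integrableP; split; first by apply/measurable_EFinP; exact: kern_measurable.
under eq_integral do rewrite /= ger0_norm ?kern_ge0//.
by rewrite integral_kern ltry.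
Qed.

End trigonometric_kernel.

(** * Fourier transforms of real step functions *)

Section step_functions.
Context {R : realType}.
Local Notation leb := (@lebesgue_measure R).
Implicit Types (u v : R -> R) (w x : R).

(** For [tr] the cosine or the sine, these are up to sign the real and imaginary
parts of the Fourier transform of [u]. *)
Definition osc (tr u : R -> R) (w : R) : R :=
  \int[leb]_x (u x * tr (2 * pi * w * x)).

Section osc_theory.
Variable tr : R -> R.
Hypothesis ctr : continuous tr.
Hypothesis tr1 : forall x, `|tr x| <= 1.

Let ctrM (w : R) : continuous (fun x => tr (w * x)).
Proof.
move=> x; apply: continuous_comp; last exact: ctr.
by apply: cvgM; [exact: cvg_cst|exact: cvg_id].
Qed.

Let ctrMr (w : R) : continuous (fun x => tr (2 * pi * x * w)).
Proof.
move=> x; apply: continuous_comp; last exact: ctr.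
by apply: cvgMl; apply: cvgM; [exact: cvg_cst|exact: cvg_id].
Qed.

Lemma osc_integrable u w : leb.-integrable setT (EFin \o u) ->
  leb.-integrable setT (EFin \o (fun x => u x * tr (2 * pi * w * x))).
Proof.
move=> iu; have mu : measurable_fun setT u.
  by move/integrableP : iu => -[/measurable_EFinP].
apply: (le_integrable measurableT _ _ iu).
  apply/measurable_EFinP; apply: measurable_funM => //.
  by apply: continuous_measurable_fun; exact: ctrM.
by move=> x _; rewrite /= lee_fin normrM ler_piMr.
Qed.

Lemma oscD u v w : leb.-integrable setT (EFin \o u) ->
  leb.-integrable setT (EFin \o v) ->
  osc tr (fun x => u x + v x) w = osc tr u w + osc tr v w.
Proof.
move=> iu iv; rewrite /osc -RintegralD//; try exact: osc_integrable.
by apply: eq_Rintegral => x _; rewrite mulrDl.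
Qed.

Lemma oscB u v w : leb.-integrable setT (EFin \o u) ->
  leb.-integrable setT (EFin \o v) ->
  osc tr (fun x => u x - v x) w = osc tr u w - osc tr v w.
Proof.
move=> iu iv; rewrite /osc -RintegralB//; try exact: osc_integrable.
by apply: eq_Rintegral => x _; rewrite mulrBl.
Qed.

Lemma oscZ (c : R) u w : leb.-integrable setT (EFin \o u) ->
  osc tr (fun x => c * u x) w = c * osc tr u w.
Proof.
move=> iu; rewrite /osc -RintegralZl//; last exact: osc_integrable.
by apply: eq_Rintegral => x _; rewrite mulrA.
Qed.

Lemma osc_le u w : leb.-integrable setT (EFin \o u) ->
  `|osc tr u w| <= \int[leb]_x `|u x|.
Proof.
move=> iu; apply: le_trans (le_normr_Rintegral measurableT (osc_integrable w iu)) _.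
apply: le_Rintegral => //.
- exact: integrable_norm (osc_integrable w iu).
- exact: integrable_norm iu.
by move=> x _; rewrite normrM ler_piMr.
Qed.

(** Dominated convergence, with |u| as dominating function. *)
Lemma osc_continuous u : leb.-integrable setT (EFin \o u) ->
  continuous (osc tr u).
Proof.
move=> iu w.
have wI : w \in [set` `]w - 1, w + 1[].
  by rewrite inE/= in_itv/= ltrBlDr ltrDl ltr01.
apply: (@continuity_under_integral _ _ _ leb
  (fun w x => u x * tr (2 * pi * w * x)) setT measurableT (w - 1) (w + 1)
  _ _ (fun x => `|u x|) _ _ w wI).
- by move=> x _; exact: osc_integrable.
- apply: aeW => x _ y _.
  by apply: cvgM; [exact: cvg_cst|exact: ctrMr].
- exact: integrable_norm iu.
- by move=> x _; apply: aeW => y _; rewrite normrM ler_piMr.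
Qed.

Lemma osc_measurable u : leb.-integrable setT (EFin \o u) ->
  measurable_fun setT (osc tr u).
Proof. by move=> iu; apply: continuous_measurable_fun; exact: osc_continuous. Qed.

End osc_theory.

Definition itv_ind (I : R * R) : R -> R := \1_(`]I.1, I.2]).

Lemma itv_ind_integrable I : leb.-integrable setT (EFin \o itv_ind I).
Proof. exact: integrable_indic_itv. Qed.

Lemma itv_ind_measurable I : measurable_fun setT (itv_ind I).
Proof. by apply: measurable_indic; exact: measurable_itv. Qed.

Lemma osc_ind (tr dtr : R -> R) I w : w != 0 -> I.1 <= I.2 ->
  continuous tr -> continuous dtr ->
  (forall x, is_derive x 1 dtr (tr x)) ->
  osc tr (itv_ind I) w = (dtr (2 * pi * w * I.2) - dtr (2 * pi * w * I.1)) / (2 * pi * w).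
Proof.
case: I => a b /= w0 ab ctr cdtr dtrE.
have pw0 : 2 * pi * w != 0 by rewrite !mulf_neq0// gt_eqF// pi_gt0.
have -> : osc tr (itv_ind (a, b)) w = \int[leb]_(x in `[a, b]) tr (2 * pi * w * x).
  rewrite [RHS]/Rintegral -integral_itv_obnd_cbnd; last first.
    apply/measurable_EFinP; apply: measurable_funTS.
    apply: continuous_measurable_fun => x.
    apply: continuous_comp; last exact: ctr.
    by apply: cvgM; [exact: cvg_cst|exact: cvg_id].
  rewrite -/(Rintegral _ _ _).
  rewrite [RHS]Rintegral_mkcond; apply: eq_Rintegral => x _.
  by rewrite /itv_ind/= patchE indicE; case: ifPn => _; rewrite (mul1r, mul0r).
move: ab; rewrite le_eqVlt => /predU1P[<-|ab].
  by rewrite set_itv1 Rintegral_set1 subrr mul0r.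
pose F x := dtr (2 * pi * w * x) / (2 * pi * w).
have dF x : is_derive x 1 F (tr (2 * pi * w * x)).
  have h : is_derive x 1 (fun y => 2 * pi * w * y) (2 * pi * w).
    have := is_deriveZ (2 * pi * w) (is_derive_id x 1).
    by rewrite [X in is_derive _ _ _ X -> _]mulr1.
  have := is_deriveZ (2 * pi * w)^-1 (is_derive1_comp (dtrE _) h).
  rewrite [X in is_derive _ _ _ X -> _](_ : _ = tr (2 * pi * w * x)); last first.
    by rewrite /GRing.scale/= mulrCA mulVf// mulr1.
  rewrite [X in is_derive _ _ X _ -> _](_ : _ = F)//.
  by rewrite /F; apply: funext => y /=; rewrite /GRing.scale/= mulrC.
rewrite /Rintegral (@continuous_FTC2 _ _ F)//.
- by rewrite /= mulrBl.
- apply: continuous_subspaceT => x; apply: continuous_comp; last exact: ctr.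
  by apply: cvgM; [exact: cvg_cst|exact: cvg_id].
- have cF : continuous F.
    move=> x; apply: cvgMl; apply: continuous_comp; last exact: cdtr.
    by apply: cvgM; [exact: cvg_cst|exact: cvg_id].
  split.
  + by move=> x _; apply: ex_derive.
  + by apply: cvg_at_right_filter; exact: cF.
  + by apply: cvg_at_left_filter; exact: cF.
- by move=> x _; rewrite derive1E; apply: derive_val.
Qed.

Lemma osc_cos_ind I w : w != 0 -> I.1 <= I.2 ->
  osc cos (itv_ind I) w = (sin (2 * pi * w * I.2) - sin (2 * pi * w * I.1)) / (2 * pi * w).
Proof.
move=> w0 I12; apply: osc_ind => //; [exact: continuous_cos|exact: continuous_sin].
Qed.

Lemma osc_sin_ind I w : w != 0 -> I.1 <= I.2 ->
  osc sin (itv_ind I) w = (cos (2 * pi * w * I.1) - cos (2 * pi * w * I.2)) / (2 * pi * w).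
Proof.
move=> w0 I12.
have d x : is_derive x 1 (fun y : R => - cos y) (sin x).
  by have := is_deriveN (is_derive_cos x); rewrite opprK.
rewrite (osc_ind w0 I12 _ _ d); last 2 first.
- exact: continuous_sin.
- by move=> x; apply: cvgN; exact: continuous_cos.
by rewrite opprK addrC.
Qed.

(** The product of the transform of one indicator with the conjugate of the other
is a combination of exponentials whose coefficients add up to 0, so that each
cosine can be replaced by the cosine minus 1. *)
Lemma osc_ind_mul I J w : w != 0 -> I.1 <= I.2 -> J.1 <= J.2 ->
  osc cos (itv_ind I) w * osc cos (itv_ind J) w + osc sin (itv_ind I) w * osc sin (itv_ind J) w =
  (2 * pi) ^- 2 * (kern (2 * pi * (I.2 - J.1)) w + kern (2 * pi * (I.1 - J.2)) w
    - kern (2 * pi * (I.2 - J.2)) w - kern (2 * pi * (I.1 - J.1)) w).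
Proof.
move=> w0 I12 J12; rewrite !osc_cos_ind// !osc_sin_ind//.
have pi0 : pi != 0 :> R by rewrite gt_eqF// pi_gt0.
have E x y : kern (2 * pi * (x - y)) w =
    (1 - (cos (2 * pi * w * x) * cos (2 * pi * w * y) +
          sin (2 * pi * w * x) * sin (2 * pi * w * y))) / w ^+ 2.
  by rewrite -cosB /kern; congr ((1 - cos _) / _); ring.
rewrite !E {E}; move: (@pi R) pi0 => p p0.
by field; rewrite w0 p0.
Qed.

(** The length of the intersection of two intervals, in the form of the right-hand
side of [osc_ind_mul]. *)
Lemma overlap_length (a b c d : R) : a <= b -> c <= d ->
  (if Num.max a c < Num.min b d then Num.min b d - Num.max a c else 0) =
  (`|b - c| + `|a - d| - `|b - d| - `|a - c|) / 2.
Proof.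
wlog ac : a b c d / a <= c.
  move=> H ab cd; have /orP[/H->//|ca] := le_total a c.
  by rewrite maxC minC H// (distrC d) (distrC c b) (distrC d b) (distrC c a); ring.
move=> ab cd.
rewrite (max_r ac) (distrC a d) (distrC a c)
  (ger0_norm (_ : 0 <= d - a)) ?subr_ge0 ?(le_trans ac)//.
rewrite (ger0_norm (_ : 0 <= c - a)) ?subr_ge0//.
have /orP[bd|db] := le_total b d; rewrite ?(min_l bd) ?(min_r db).
  rewrite (distrC b d) (ger0_norm (_ : 0 <= d - b)) ?subr_ge0//.
  by have [cb|bc] := ltP c b; [rewrite gtr0_norm|rewrite ler0_norm];
    rewrite ?subr_gt0 ?subr_le0//; field.
rewrite (ger0_norm (_ : 0 <= b - d)) ?subr_ge0//
  (ger0_norm (_ : 0 <= b - c)) ?subr_ge0 ?(le_trans cd)//.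
by case: ltP => dc; [field|have -> : c = d by [apply/le_anti; rewrite cd dc]; field].
Qed.

Lemma integral_ind_mul I J : I.1 <= I.2 -> J.1 <= J.2 ->
  (\int[leb]_x (itv_ind I x * itv_ind J x)%:E =
   ((`|I.2 - J.1| + `|I.1 - J.2| - `|I.2 - J.2| - `|I.1 - J.1|) / 2)%:E)%E.
Proof.
case: I J => [a b] [c d] /= ab cd.
transitivity (\int[leb]_x (\1_(`]a, b]%classic `&` `]c, d]%classic) x)%:E)%E.
  by apply: eq_integral => x _; rewrite /itv_ind indicI.
rewrite integral_indic//=; last by apply: measurableI; exact: measurable_itv.
rewrite setIT.
have -> : `]a, b]%classic `&` `]c, d]%classic = `]Num.max a c, Num.min b d]%classic.
  apply/seteqP; split => x /=; rewrite !in_itv/= gt_max le_min.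
    by move=> [/andP[-> ->] /andP[-> ->]].
  by move=> /andP[/andP[-> ->] /andP[-> ->]].
rewrite lebesgue_measure_itv/= lte_fin -overlap_length//.
by case: ifPn.
Qed.

Lemma itv_ind_mul_integrable I J :
  leb.-integrable setT (EFin \o (fun x => itv_ind I x * itv_ind J x)).
Proof.
apply: (le_integrable measurableT _ _ (itv_ind_integrable I)).
  by apply/measurable_EFinP; apply: measurable_funM; exact: itv_ind_measurable.
move=> x _; rewrite /= lee_fin normrM ler_piMr// /itv_ind indicE.
by case: (_ \in _); rewrite ?normr1 ?normr0.
Qed.

(** Sorting the end points spares step functions a well-formedness condition. *)
Definition sort_ends (I : R * R) : R * R := (Num.min I.1 I.2, Num.max I.1 I.2).

Lemma sort_ends_le I : (sort_ends I).1 <= (sort_ends I).2.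
Proof. by rewrite /sort_ends/= ge_min le_max lexx. Qed.

(** A triple (c, (a, b)) stands for c times the indicator of an interval with end
points a and b; the intervals may overlap, so that sums are concatenations. *)
Definition stepf (s : seq (R * (R * R))) (x : R) : R :=
  \sum_(p <- s) p.1 * itv_ind (sort_ends p.2) x.

Lemma stepf_measurable s : measurable_fun setT (stepf s).
Proof.
apply: measurable_sum => p; apply: measurable_funM => //.
exact: itv_ind_measurable.
Qed.

Lemma stepf_integrable s : leb.-integrable setT (EFin \o stepf s).
Proof.
have -> : EFin \o stepf s = (fun x => (\sum_(p <- s) p.1%:E * (itv_ind (sort_ends p.2) x)%:E)%E).
  by apply/funext => x; rewrite /= /stepf -sumEFin.
apply: integrable_sum => // p _.
by apply: integrableZl => //; exact: itv_ind_integrable.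
Qed.

Lemma osc_stepf tr s w : continuous tr -> (forall x, `|tr x| <= 1) ->
  osc tr (stepf s) w = \sum_(p <- s) p.1 * osc tr (itv_ind (sort_ends p.2)) w.
Proof.
move=> ctr tr1; elim: s => [|p s IH].
  rewrite big_nil /osc; under eq_Rintegral do rewrite /stepf big_nil mul0r.
  by rewrite /Rintegral integral0.
rewrite big_cons -IH -oscZ ?itv_ind_integrable// -oscD ?stepf_integrable//.
  by rewrite /stepf; under eq_fun do rewrite big_cons.
by have := integrableZl measurableT p.1 (itv_ind_integrable (sort_ends p.2)).
Qed.

Lemma stepfB s s' : exists s'', stepf s'' = (fun x => stepf s x - stepf s' x).
Proof.
exists (s ++ [seq (- p.1, p.2) | p <- s']); apply/funext => x.
rewrite /stepf big_cat big_map/= -sumrN; congr (_ + _).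
by apply: eq_bigr => p _; rewrite mulNr.
Qed.

Lemma integral_sum2 (s : seq (R * (R * R))) (m : R * R -> R * R -> R)
    (f : R * R -> R * R -> R -> R) :
  (forall p q, leb.-integrable setT (EFin \o f p q)) ->
  (forall p q, (\int[leb]_x (f p q x)%:E = (m p q)%:E)%E) ->
  (\int[leb]_x (\sum_(p <- s) \sum_(q <- s) p.1 * q.1 * f p.2 q.2 x)%:E =
   (\sum_(p <- s) \sum_(q <- s) p.1 * q.1 * m p.2 q.2)%:E)%E.
Proof.
move=> fi fm.
have cfi (p q : R * (R * R)) : leb.-integrable setT
    (fun x => ((p.1 * q.1)%:E * (f p.2 q.2 x)%:E)%E).
  by apply: integrableZl => //; exact: fi.
under eq_integral.
  move=> x _; rewrite -sumEFin.
  under eq_bigr do (rewrite -sumEFin; under eq_bigr do rewrite EFinM).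
  over.
rewrite integral_sum//; last by move=> p; apply: integrable_sum.
rewrite -sumEFin; apply: eq_bigr => p _.
rewrite integral_sum// -sumEFin; apply: eq_bigr => q _.
by rewrite integralZl//; [rewrite fm -EFinM|exact: fi].
Qed.

Lemma stepf_sqr s x : stepf s x ^+ 2 =
  \sum_(p <- s) \sum_(q <- s) p.1 * q.1 * (itv_ind (sort_ends p.2) x * itv_ind (sort_ends q.2) x).
Proof.
rewrite expr2 /stepf big_distrlr/=.
by apply: eq_bigr => p _; apply: eq_bigr => q _; rewrite mulrACA.
Qed.

(** The squared modulus of the Fourier transform of a real function. *)
Definition spectrum (u : R -> R) w : R := osc cos u w ^+ 2 + osc sin u w ^+ 2.

Lemma spectrum_ge0 u w : 0 <= spectrum u w.
Proof. by rewrite addr_ge0// sqr_ge0. Qed.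

Lemma spectrum_measurable u : leb.-integrable setT (EFin \o u) ->
  measurable_fun setT (spectrum u).
Proof.
move=> iu; apply: measurable_funD; apply: measurable_funX; apply: osc_measurable => //.
- exact: continuous_cos.
- exact: cos_max.
- exact: continuous_sin.
- exact: sin_max.
Qed.

(** Both sides are quadratic in the step function, and agree on every pair of
intervals by [osc_ind_mul], [integral_kern] and [integral_ind_mul]. *)
Lemma plancherel_stepf s :
  (\int[leb]_w (spectrum (stepf s) w)%:E =
   (kappa / pi)%:E * \int[leb]_x (stepf s x ^+ 2)%:E)%E.
Proof.
have pi0 : pi != 0 :> R by rewrite gt_eqF// pi_gt0.
pose K (I J : R * R) w := (2 * pi) ^- 2 *
  (kern (2 * pi * ((sort_ends I).2 - (sort_ends J).1)) w
    + kern (2 * pi * ((sort_ends I).1 - (sort_ends J).2)) w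
    - kern (2 * pi * ((sort_ends I).2 - (sort_ends J).2)) w
    - kern (2 * pi * ((sort_ends I).1 - (sort_ends J).1)) w).
pose O (I J : R * R) := (`|(sort_ends I).2 - (sort_ends J).1|
  + `|(sort_ends I).1 - (sort_ends J).2| -
  `|(sort_ends I).2 - (sort_ends J).2| - `|(sort_ends I).1 - (sort_ends J).1|) / 2.
have E w : w != 0 -> spectrum (stepf s) w =
    \sum_(p <- s) \sum_(q <- s) p.1 * q.1 * K p.2 q.2 w.
  move=> w0; rewrite /spectrum !osc_stepf; last 4 first.
    exact: continuous_sin. exact: sin_max. exact: continuous_cos. exact: cos_max.
  rewrite !expr2 !big_distrlr/= -big_split/=; apply: eq_bigr => p _.
  rewrite -big_split/=; apply: eq_bigr => q _.
  by rewrite /K -osc_ind_mul ?sort_ends_le//; ring.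
have iK4 (a b c d : R) : leb.-integrable setT (EFin \o (fun w =>
      (2 * pi) ^- 2 * (kern a w + kern b w - kern c w - kern d w))) /\
    (\int[leb]_w ((2 * pi) ^- 2 * (kern a w + kern b w - kern c w - kern d w))%:E =
    ((2 * pi) ^- 2 * (`|a| + `|b| - `|c| - `|d|) * kappa)%:E)%E.
  have ik := @kern_integrable R.
  have i1 := integrableD measurableT (ik a) (ik b).
  have i2 := integrableB measurableT i1 (ik c).
  have i3 := integrableB measurableT i2 (ik d).
  split; first exact: (integrableZl measurableT _ i3).
  have := integralZl measurableT i3 ((2 * pi) ^- 2); rewrite !integralB// integralD// => -> /=.
  by rewrite !integral_kern -!EFinD -EFinM; congr EFin; ring.
have iK I J : leb.-integrable setT (EFin \o K I J) by have [] := iK4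
  (2 * pi * ((sort_ends I).2 - (sort_ends J).1)) (2 * pi * ((sort_ends I).1 - (sort_ends J).2))
  (2 * pi * ((sort_ends I).2 - (sort_ends J).2)) (2 * pi * ((sort_ends I).1 - (sort_ends J).1)).
have mK I J : (\int[leb]_w (K I J w)%:E = (kappa / pi * O I J)%:E)%E.
  rewrite /K (iK4 _ _ _ _).2 !normrM (ger0_norm (pi_ge0 R)) (ger0_norm (ler0n R 2)).
  by congr EFin; rewrite /O; move: (@pi R) pi0 => p p0; field.
transitivity (\int[leb]_w (\sum_(p <- s) \sum_(q <- s) p.1 * q.1 * K p.2 q.2 w)%:E)%E.
  have mS : measurable_fun setT (fun w => (\sum_(p <- s) \sum_(q <- s) p.1 * q.1 * K p.2 q.2 w)%:E).
    apply/measurable_EFinP; apply: measurable_sum => p; apply: measurable_sum => q.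
    apply: measurable_funM => //.
    by have /integrableP[/measurable_EFinP] := iK p.2 q.2.
  (* The explicit formula for the transforms holds for w <> 0 only. *)
  rewrite -(@integral_setD1 _ _ 0 setT); last 2 first.
  - by apply: measurableD.
  - apply: measurable_funTS; apply/measurable_EFinP.
    by apply: spectrum_measurable; exact: stepf_integrable.
  rewrite -[RHS](@integral_setD1 _ _ 0 setT); last 2 first.
  - by apply: measurableD.
  - exact: measurable_funTS.
  apply: eq_integral => w; rewrite inE/= => -[_ /= /eqP w0].
  by rewrite E.
rewrite (integral_sum2 _ iK mK).
under [in RHS]eq_integral do rewrite stepf_sqr.
rewrite (@integral_sum2 _ O (fun I J x => itv_ind (sort_ends I) x * itv_ind (sort_ends J) x)).
- rewrite -EFinM; congr EFin; rewrite mulr_sumr; apply: eq_bigr => p _.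
  rewrite mulr_sumr; apply: eq_bigr => q _; ring.
- by move=> p q; exact: itv_ind_mul_integrable.
- by move=> p q; apply: integral_ind_mul; exact: sort_ends_le.
Qed.
End step_functions.

(** * Limits of extended reals and squared norms *)

Section ereal_limits.
Context {R : realType}.
Local Open Scope ereal_scope.

Lemma cvge0_lt (f : nat -> \bar R) (e : R) : f @ \oo --> 0 -> (0 < e)%R ->
  \forall k \near \oo, f k < e%:E.
Proof.
move=> f0 e0; apply: (f0 [set x | x < e%:E]).
by apply: open_nbhs_nbhs; split; [exact: open_ereal_lt_ereal|rewrite /= lte_fin].
Qed.

Lemma cvge0P (f : nat -> \bar R) : (forall k, 0 <= f k) ->
  (forall e : R, (0 < e)%R -> \forall k \near \oo, f k <= e%:E) ->
  f @ \oo --> 0.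
Proof.
move=> f0 H; apply/fine_cvgP; split.
  have [N _ h] := H 1%R ltr01; exists N => // k Nk /=.
  by rewrite ge0_fin_numE// (le_lt_trans (h _ Nk))// ltry.
apply/cvgrPdist_le => e e0; have [N _ h] := H e e0; exists N => // k Nk /=.
have := h _ Nk; move: (f0 k); case: (f k) => //= r.
by rewrite !lee_fin => r0 re; rewrite sub0r normrN ger0_norm.
Qed.

Lemma limn_einf_le (f : nat -> \bar R) (B : \bar R) : (forall k, f k <= B) ->
  limn_einf f <= B.
Proof.
move=> fB; rewrite limn_einf_lim; apply: lime_le; first exact: is_cvg_einfs.
by apply: nearW => n; apply: le_trans (fB n); apply: ereal_inf_lbound; exists n => /=.
Qed.

Lemma lee_addMgt0P (x y : \bar R) (K : R) :
  (forall e : R, (0 < e)%R -> x <= y + (K * e)%:E) -> x <= y.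
Proof.
move=> H; apply/lee_addgt0Pr => e e0.
have K0 : (0 < `|K| + 1)%R by rewrite ltr_wpDl.
apply: le_trans (H (e / (`|K| + 1))%R (divr_gt0 e0 K0)) _.
rewrite leeD2l// lee_fin mulrA ler_pdivrMr// mulrC ler_wpM2l ?(ltW e0)//.
by rewrite (le_trans (ler_norm _))// lerDl.
Qed.

Lemma mule2_inj (x y : \bar R) : (2%:E * x = 2%:E * y)%E -> x = y.
Proof.
move=> E; apply/le_anti.
by apply/andP; split; rewrite -(@lee_pmul2l _ 2%:E)// E.
Qed.

End ereal_limits.

Lemma ae_imp d (T : measurableType d) (R : realType)
    (mu : {measure set T -> \bar R}) (P Q : T -> Prop) :
  (forall x, P x -> Q x) -> {ae mu, forall x, P x} -> {ae mu, forall x, Q x}.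
Proof. by move=> PQ; exact: filterS. Qed.

Section square_norm.
Context d (T : measurableType d) (R : realType).
Variables (mu : {measure set T -> \bar R}) (D : set T).
Hypothesis mD : measurable D.
Implicit Types u v w : T -> R.

(** Squares are used throughout, with |a + b|^2 <= 2 |a|^2 + 2 |b|^2 in place of the
triangle inequality, to avoid square roots of extended reals. *)
Definition norm2 u : \bar R := (\int[mu]_(x in D) (u x ^+ 2)%:E)%E.

Lemma norm2_ge0 u : (0 <= norm2 u)%E.
Proof. by apply: integral_ge0 => x _; rewrite lee_fin sqr_ge0. Qed.

Lemma measurable_sqr u : measurable_fun D u ->
  measurable_fun D (fun x => (u x ^+ 2)%:E).
Proof. by move=> mu_; apply/measurable_EFinP; apply: measurable_funX. Qed.

Lemma norm2D_le u v : measurable_fun D u -> measurable_fun D v ->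
  (norm2 (fun x => u x + v x)%R <= 2%:E * norm2 u + 2%:E * norm2 v)%E.
Proof.
move=> mu_ mv; rewrite /norm2 -!ge0_integralZl//; first last.
- by move=> x _; rewrite lee_fin sqr_ge0.
- exact: measurable_sqr.
- by move=> x _; rewrite lee_fin sqr_ge0.
- exact: measurable_sqr.
rewrite -ge0_integralD//; first last.
- by apply: measurable_funeM => //; exact: measurable_sqr.
- by move=> x _; rewrite mule_ge0// lee_fin// sqr_ge0.
- by apply: measurable_funeM => //; exact: measurable_sqr.
- by move=> x _; rewrite mule_ge0// lee_fin// sqr_ge0.
apply: ge0_le_integral => //.
- by move=> x _; rewrite lee_fin sqr_ge0.
- by apply: measurable_sqr; exact: measurable_funD.
- by apply: emeasurable_funD; apply: measurable_funeM => //; exact: measurable_sqr.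
move=> x _; rewrite -!EFinM -EFinD lee_fin.
have := sqr_ge0 (u x - v x); nra.
Qed.

Lemma norm2_sub_le u v w : measurable_fun D u -> measurable_fun D v ->
  measurable_fun D w ->
  (norm2 (fun x => u x - w x)%R <=
   2%:E * norm2 (fun x => u x - v x)%R + 2%:E * norm2 (fun x => v x - w x)%R)%E.
Proof.
move=> mu_ mv mw.
have -> : (fun x => u x - w x) = (fun x => (u x - v x) + (v x - w x)).
  by apply/funext => x; ring.
by apply: norm2D_le; exact: measurable_funB.
Qed.

Lemma norm2_subC u v : norm2 (fun x => u x - v x)%R = norm2 (fun x => v x - u x)%R.
Proof. by apply: eq_integral => x _; rewrite -sqrrN opprB. Qed.

Lemma integrable_of_bound u v : measurable_fun D u ->
  mu.-integrable D (EFin \o v) -> (forall x, D x -> `|u x| <= v x) ->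
  mu.-integrable D (EFin \o u).
Proof.
move=> mu_ iv uv; apply: (le_integrable mD _ _ iv).
  exact/measurable_EFinP.
by move=> x Dx; rewrite /= lee_fin (le_trans (uv x Dx))// ler_norm.
Qed.

Lemma integrable_sqr u : measurable_fun D u ->
  (norm2 u < +oo)%E <-> mu.-integrable D (EFin \o (fun x => u x ^+ 2)).
Proof.
move=> mu_; split => [h|/integrableP[_]].
  apply/integrableP; split; first exact: measurable_sqr.
  by under eq_integral do rewrite /= ger0_norm ?sqr_ge0//.
by under eq_integral do rewrite /= ger0_norm ?sqr_ge0//.
Qed.

End square_norm.

(** * Density of step functions *)

Section density.
Context {R : realType}.
Local Notation leb := (@lebesgue_measure R).
Local Notation lnorm2 := (norm2 leb setT).
Implicit Types (u v w g : R -> R).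

(** Approximation in both norms at once: the L1 norm controls the Fourier integral
pointwise, the L2 norm controls energies. *)
Definition step_approx u := measurable_fun setT u /\
  forall e : R, 0 < e -> exists s,
    (\int[leb]_x (`|u x - stepf s x|)%:E <= e%:E)%E /\
    (lnorm2 (fun x => u x - stepf s x)%R <= e%:E)%E.

Lemma step_approx_stepf s : step_approx (stepf s).
Proof.
split; first exact: stepf_measurable.
move=> e e0; exists s; split.
  rewrite integral0_eq ?lee_fin ?ltW// => x _.
  by rewrite subrr normr0.
rewrite /norm2 integral0_eq ?lee_fin ?ltW// => x _.
by rewrite subrr expr0n.
Qed.

Lemma integral_normB_le u v w : measurable_fun setT u -> measurable_fun setT v ->
  measurable_fun setT w ->
  (\int[leb]_x (`|u x - w x|)%:E <=
   \int[leb]_x (`|u x - v x|)%:E + \int[leb]_x (`|v x - w x|)%:E)%E.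
Proof.
move=> mu mv mw.
have mB (f g : R -> R) : measurable_fun setT f -> measurable_fun setT g ->
    measurable_fun setT (fun x : R => (`|f x - g x|)%:E).
  move=> mf mg; apply/measurable_EFinP; apply: measurableT_comp => //.
  exact: measurable_funB.
rewrite -ge0_integralD//; try exact: mB.
apply: ge0_le_integral => //; try exact: mB.
  by apply: emeasurable_funD; exact: mB.
by move=> x _; rewrite -EFinD lee_fin ler_distD.
Qed.

Lemma step_approx_closed u : measurable_fun setT u ->
  (forall e : R, 0 < e -> exists v, [/\ step_approx v,
    (\int[leb]_x (`|u x - v x|)%:E <= e%:E)%E &
    (lnorm2 (fun x => u x - v x)%R <= e%:E)%E]) ->
  step_approx u.
Proof.
move=> mu H; split => // e e0.
have e4 : 0 < e / 4 by rewrite divr_gt0.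
have [v [[mv Hv] uv1 uv2]] := H _ e4.
have [s [vs1 vs2]] := Hv _ e4; exists s.
have ms := @stepf_measurable R s.
split.
  apply: le_trans (integral_normB_le mu mv ms) _.
  apply: le_trans (leeD uv1 vs1) _.
  by rewrite -EFinD lee_fin; lra.
apply: le_trans (norm2_sub_le leb measurableT mu mv ms) _.
apply: (@le_trans _ _ (2%:E * (e / 4)%:E + 2%:E * (e / 4)%:E)%E).
  by apply: leeD; rewrite lee_pmul2l// lte_fin.
by rewrite -!EFinM -EFinD lee_fin; lra.
Qed.

(** Dominated convergence holds for the L1 and the L2 distances together. *)
Lemma step_approx_dominated (u_ : nat -> R -> R) u h :
  (forall k, step_approx (u_ k)) -> measurable_fun setT u ->
  (forall x, u_ ^~ x @ \oo --> u x) ->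
  (forall k x, `|u x - u_ k x| <= h x) ->
  leb.-integrable setT (EFin \o h) ->
  leb.-integrable setT (EFin \o (fun x => h x ^+ 2)) ->
  step_approx u.
Proof.
move=> au mu uu uh ih ih2; apply: step_approx_closed => // e e0.
have md k : measurable_fun setT (fun x => u x - u_ k x).
  by apply: measurable_funB => //; have [] := au k.
have du x : (fun k => u x - u_ k x) @ \oo --> 0.
  by rewrite -(subrr (u x)); apply: cvgB; [exact: cvg_cst|exact: uu].
have h0 x : 0 <= h x by rewrite (le_trans _ (uh 0%N x)).
have /cvge0_lt/(_ e0)[N1 _ H1] :
    (fun k => (\int[leb]_x (`|u x - u_ k x|)%:E)%E) @ \oo --> 0%E.
  have := @dominated_cvg _ _ _ leb setT measurableT
    (fun k x => (`|u x - u_ k x|)%:E) (fun=> 0%E) (EFin \o h).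
  rewrite integral0; apply => //.
  - by move=> k; apply/measurable_EFinP; apply: measurableT_comp => //; exact: md.
  - move=> x _; apply: cvg_EFin; first exact: nearW.
    by rewrite -(@normr0 _ R); apply: cvg_norm; exact: du.
  - by move=> k x _; rewrite /= lee_fin normr_id.
have /cvge0_lt/(_ e0)[N2 _ H2] :
    (fun k => lnorm2 (fun x => u x - u_ k x)) @ \oo --> 0%E.
  have := @dominated_cvg _ _ _ leb setT measurableT
    (fun k x => ((u x - u_ k x) ^+ 2)%:E) (fun=> 0%E) (EFin \o (fun x => h x ^+ 2)).
  rewrite integral0; apply => //.
  - by move=> k; apply/measurable_EFinP; apply: measurable_funX; exact: md.
  - move=> x _; apply: cvg_EFin; first exact: nearW.
    have -> : 0 = 0 * 0 :> R by rewrite mulr0.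
    by apply: cvgM; exact: du.
  - move=> k x _; rewrite /= lee_fin normrX lerXn2r// nnegrE//.
exists (u_ (maxn N1 N2)); split; first exact: au.
- by apply/ltW/H1; rewrite /= leq_maxl.
- by apply/ltW/H2; rewrite /= leq_maxr.
Qed.

(** Samples of [g] at the left end points of [m] consecutive cells of length
[delta] starting at [a]. *)
Definition grid_steps g (a delta : R) (m : nat) : seq (R * (R * R)) :=
  [seq (g (a + delta * j%:R), (a + delta * j%:R, a + delta * j.+1%:R)) | j <- iota 0 m].

Lemma grid_stepsE g (a delta : R) m x : 0 < delta ->
  (~ (a < x <= a + delta * m%:R) -> stepf (grid_steps g a delta m) x = 0) /\
  (a < x <= a + delta * m%:R -> exists t,
     [/\ a <= t, t <= x, x <= t + delta & stepf (grid_steps g a delta m) x = g t]).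
Proof.
move=> d0; elim: m => [|m [IH0 IH1]].
  rewrite mulr0 addr0; split; first by rewrite /stepf big_nil.
  by move=> /andP[ax xa]; have := lt_le_trans ax xa; rewrite ltxx.
have S : stepf (grid_steps g a delta m.+1) x = stepf (grid_steps g a delta m) x +
    g (a + delta * m%:R) * itv_ind (a + delta * m%:R, a + delta * m.+1%:R) x.
  have mm : a + delta * m%:R <= a + delta * m.+1%:R.
    by rewrite lerD2l ler_pM2l// ler_nat.
  rewrite /stepf /grid_steps -addn1 iotaD map_cat big_cat big_seq1/= /sort_ends/=.
  by rewrite addn1 (min_l mm) (max_r mm).
have dS : delta * m.+1%:R = delta * m%:R + delta by rewrite mulrSr mulrDr mulr1.
have dm : 0 <= delta * m%:R by rewrite mulr_ge0// ltW.
have itv_indE : itv_ind (a + delta * m%:R, a + delta * m.+1%:R) x =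
    (a + delta * m%:R < x <= a + delta * m.+1%:R)%R%:R.
  by rewrite /itv_ind indicE mem_setE in_itv.
have [lt1|le1] := ltP (a + delta * m%:R) x.
  have z : stepf (grid_steps g a delta m) x = 0.
    by apply: IH0 => /andP[_]; rewrite leNgt lt1.
  rewrite S z add0r itv_indE lt1/=; split => [n|/andP[ax xa]].
    case: (leP x (a + delta * m.+1%:R)) => xa; last by rewrite mulr0.
    by case: n; rewrite xa andbT (le_lt_trans _ lt1)// lerDl.
  exists (a + delta * m%:R); rewrite xa mulr1; split => //.
  - by rewrite lerDl.
  - exact: ltW.
  - by rewrite -addrA -dS.
rewrite S itv_indE (ltNge (a + delta * m%:R)) le1/= mulr0 addr0; split => [n|/andP[ax xa]].
  apply: IH0 => /andP[ax _]; apply: n; rewrite ax (le_trans le1)// lerD2l dS lerDl ltW//.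
by apply: IH1; rewrite ax.
Qed.

(** Samples on finer and finer grids converge pointwise by continuity, and are
bounded by [M] on the window. *)
Lemma step_approx_continuous g (N : nat) (M : R) : continuous g ->
  (forall x, `|g x| <= M) ->
  step_approx (fun x => g x * itv_ind (- N%:R, N%:R) x).
Proof.
move=> cg gM; have M0 : 0 <= M by rewrite (le_trans _ (gM 0)).
pose u_ k := stepf (grid_steps g (- N%:R) k.+1%:R^-1 (2 * N * k.+1)).
have kN k : - N%:R + k.+1%:R^-1 * (2 * N * k.+1)%:R = N%:R :> R.
  rewrite natrM mulrA mulrAC mulVf ?pnatr_eq0// mul1r natrM; ring.
have itv_indE x : itv_ind (- N%:R, N%:R) x = (- N%:R < x <= N%:R)%R%:R :> R.
  by rewrite /itv_ind indicE mem_setE in_itv.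
have k0 k : 0 < k.+1%:R^-1 :> R by rewrite invr_gt0.
have uE k x : (~ (- N%:R < x <= N%:R) -> u_ k x = 0) /\
    (- N%:R < x <= N%:R -> exists t, [/\ t <= x, x <= t + k.+1%:R^-1 & u_ k x = g t]).
  have [] := grid_stepsE g (- N%:R) (2 * N * k.+1) x (k0 k); rewrite kN => H0 H1.
  by split=> // /H1[t [_ tx xt E]]; exists t.
apply: (@step_approx_dominated u_ _ (fun x => M *+ 2 * itv_ind (- N%:R, N%:R) x)).
- by move=> k; exact: step_approx_stepf.
- apply: measurable_funM; first exact: continuous_measurable_fun.
  exact: itv_ind_measurable.
- move=> x; rewrite itv_indE; have [xN|xN] := boolP (- N%:R < x <= N%:R); last first.
    rewrite mulr0; apply: cvg_near_cst; apply: nearW => k.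
    by have [-> //] := uE k x; apply/negP.
  rewrite mulr1; apply/cvgrPdist_le => e e0.
  have /cvgrPdist_le/(_ _ e0) := cg x.
  move=> /nbhs_ballP[d /= d0 Hd].
  near=> k.
  have [_ /(_ xN)[t [tx xt ->]]] := uE k x.
  apply: Hd; rewrite /ball/= ger0_norm ?subr_ge0//.
  rewrite (@le_lt_trans _ _ k.+1%:R^-1) ?lerBlDl//.
  by near: k; exact: near_infty_natSinv_lt (PosNum d0).
- move=> k x; rewrite itv_indE; have [xN|xN] := boolP (- N%:R < x <= N%:R); last first.
    rewrite ((uE k x).1 (elimN idP xN)).
    by rewrite !mulr0 subr0 normr0.
  have [_ /(_ xN)[t [_ _ ->]]] := uE k x.
  by rewrite !mulr1 (le_trans (ler_normB _ _))// mulr2n lerD.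
- by have := integrableZl measurableT (M *+ 2) (itv_ind_integrable (- N%:R, N%:R)).
- have -> : (fun x => (M *+ 2 * itv_ind (- N%:R, N%:R) x) ^+ 2) =
      (fun x => (M *+ 2) ^+ 2 * itv_ind (- N%:R, N%:R) x).
    apply/funext => x; rewrite exprMn; congr (_ * _).
    by rewrite itv_indE; case: (_ && _); rewrite ?expr1n ?expr0n.
  by have := integrableZl measurableT ((M *+ 2) ^+ 2) (itv_ind_integrable (- N%:R, N%:R)).
Unshelve. all: by end_near. Qed.

Lemma step_approx_bounded v (N : nat) (M : R) : measurable_fun setT v ->
  (forall x, `|v x| <= M) -> (forall x, ~ (- N%:R < x <= N%:R) -> v x = 0) ->
  step_approx v.
Proof.
move=> mv vM vN; have M0 : 0 <= M by rewrite (le_trans _ (vM 0)).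
pose E : set R := `]- N%:R, N%:R]%classic.
have mE : measurable E by exact: measurable_itv.
have Efin : (leb E < +oo)%E.
  by rewrite /E lebesgue_measure_itv/=; case: ifPn => _; rewrite ?ltry// -EFinD ltry.
have itv_indE x : itv_ind (- N%:R, N%:R) x = (x \in E)%:R :> R by rewrite /itv_ind indicE.
have iv : leb.-integrable E (EFin \o v).
  apply: measurable_bounded_integrable => //; first exact: measurable_funTS.
  by exists M; split; rewrite ?num_real// => y My x _ /=; exact: le_trans (vM x) (ltW My).
have [g [cg _ gv]] := approximation_continuous_integrable mE Efin iv.
apply: step_approx_closed => // e e0.
have e1 : 0 < e / (M *+ 2 + 1) by rewrite divr_gt0// ltr_wpDl// mulrn_wge0.
have [k _ /(_ k (leqnn k)) gk] := cvge0_lt gv e1.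
(* Clipping the approximant brings it closer to [v] and bounds the difference by
   2M, so that the L1 distance controls the L2 distance. *)
pose c x := Num.max (- M) (Num.min M (g k x)).
have NM : - M <= M by rewrite (le_trans _ M0)// oppr_le0.
have cM x : `|c x| <= M.
  by rewrite ler_norml /c le_max lexx/= ge_max NM ge_min lexx.
have cc : continuous c.
  move=> x; apply: (@continuous_max R R (fun=> - M) (fun y => Num.min M (g k y))).
    exact: cvg_cst.
  by apply: (@continuous_min R R (fun=> M) (g k)); [exact: cvg_cst|exact: cg].
have cv x : `|v x - c x| <= `|v x - g k x|.
  have /ler_normlP[v1 v2] := vM x; rewrite /c; have [Mg|gM] := ltP M (g k x).
    rewrite (max_r NM) ler0_norm ?subr_le0// ler0_norm ?subr_le0; lra.
  have [//|gNM] := leP (- M) (g k x).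
  by rewrite ger0_norm ?subr_ge0 1?lerNl// ger0_norm ?subr_ge0; lra.
have m0 : measurable_fun setT (fun x => v x - c x * itv_ind (- N%:R, N%:R) x).
  apply: measurable_funB => //; apply: measurable_funM; last exact: itv_ind_measurable.
  exact: continuous_measurable_fun.
have D1 x : `|v x - c x * itv_ind (- N%:R, N%:R) x| <= M *+ 2.
  rewrite (le_trans (ler_normB _ _))// mulr2n lerD// normrM itv_indE.
  by case: (_ \in _); rewrite ?normr1 ?normr0 ?mulr1// mulr0.
have L1 : (\int[leb]_x `|v x - c x * itv_ind (- N%:R, N%:R) x|%:E <= (e / (M *+ 2 + 1))%:E)%E.
  apply: le_trans (ltW gk); rewrite [leRHS]integral_mkcond.
  apply: ge0_le_integral => //.
  - by apply/measurable_EFinP; exact: measurableT_comp.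
  - apply/(measurable_restrictT _ mE)/measurable_funTS.
    apply/measurable_EFinP; apply: measurableT_comp => //; apply: measurable_funB => //.
    exact: continuous_measurable_fun.
  - move=> x _; rewrite patchE itv_indE; case: ifPn => xE; first by rewrite mulr1/= lee_fin.
    by rewrite mulr0 subr0 vN ?normr0// => xN; move: xE; rewrite notin_setE /E/= in_itv/= xN.
exists (fun x => c x * itv_ind (- N%:R, N%:R) x); split.
- exact: step_approx_continuous cc cM.
- apply: le_trans L1 _; rewrite lee_fin ler_pdivrMr ?ltr_wpDl// ?mulrn_wge0//.
  by rewrite ler_peMr ?(ltW e0)// lerDr mulrn_wge0.
apply: (@le_trans _ _ ((M *+ 2)%:E * (e / (M *+ 2 + 1))%:E)%E); last first.
  rewrite -EFinM lee_fin mulrA ler_pdivrMr ?ltr_wpDl ?mulrn_wge0//.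
  by rewrite mulrC ler_pM2l// lerDl.
apply: le_trans (lee_wpmul2l _ L1); last by rewrite lee_fin mulrn_wge0.
rewrite -ge0_integralZl//; last 2 first.
- by apply/measurable_EFinP; exact: measurableT_comp.
- by rewrite lee_fin mulrn_wge0.
apply: ge0_le_integral => //.
- by move=> x _; rewrite lee_fin sqr_ge0.
- exact: measurable_sqr.
- apply/measurable_EFinP; apply: measurable_funM => //.
  exact: measurableT_comp.
- by move=> x _; rewrite -EFinM lee_fin -real_normK ?num_real// expr2 ler_wpM2r.
Qed.

(** Cut off the values of [u] where the argument or the value is large. *)
Lemma step_approx_L1L2 u : leb.-integrable setT (EFin \o u) ->
  (lnorm2 u < +oo)%E -> step_approx u.
Proof.
move=> iu u2; have mu : measurable_fun setT u by move/integrableP: iu => -[/measurable_EFinP].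
have absu : measurable_fun setT (fun x => `|u x|) by exact: measurableT_comp.
pose cut (k : nat) x := u x * itv_ind (- k%:R, k%:R) x * \1_[set x | `|u x| <= k%:R] x.
have mk k : measurable [set x | `|u x| <= k%:R].
  rewrite (_ : [set x | _] = (fun x => `|u x|) @^-1` `]-oo, k%:R]%classic); last first.
    by apply/seteqP; split => x /=; rewrite in_itv.
  rewrite -[X in measurable X]setTI; apply: absu => //; exact: measurable_itv.
have cutE k x : cut k x = u x * ((- k%:R < x <= k%:R) && (`|u x| <= k%:R))%R%:R.
  rewrite /cut /itv_ind !indicE mem_setE in_itv/= -mulrA -natrM mulnb; congr (_ * (_ && _)%:R).
  by apply/idP/idP; rewrite inE.
apply: (@step_approx_dominated cut _ (fun x => `|u x|)) => //.
- move=> k; apply: (@step_approx_bounded _ k k%:R).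
  + apply: measurable_funM; last exact: measurable_indic.
    by apply: measurable_funM => //; exact: itv_ind_measurable.
  + move=> x; rewrite cutE; have [/andP[_ uk]|_] := boolP (_ && (_ <= _)).
      by rewrite mulr1.
    by rewrite mulr0 normr0.
  + by move=> x /negP/negbTE xk; rewrite cutE xk mulr0.
- move=> x; apply: cvg_near_cst; near=> k.
  rewrite cutE (_ : _ && _) ?mulr1//.
  have /ler_normlP[x1 x2] : `|x| <= k%:R by near: k; exact: nbhs_infty_ger.
  have xk : `|x| < k%:R by near: k; exact: nbhs_infty_gtr.
  apply/andP; split; last by near: k; exact: nbhs_infty_ger.
  by rewrite x2 andbT; move: xk; rewrite ltr_norml => /andP[].
- move=> k x; rewrite cutE; case: (_ && _); last by rewrite mulr0 subr0.
  by rewrite mulr1 subrr normr0.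
- exact: integrable_norm.
- rewrite (_ : (fun x => `|u x| ^+ 2) = (fun x => u x ^+ 2)).
    exact: (integrable_sqr leb mu).1 u2.
  by apply/funext => x; rewrite real_normK ?num_real.
Unshelve. all: by end_near. Qed.

End density.

(** * Norm bounds for the transform of a real function *)

Section real_frame_bounds.
Context {R : realType}.
Local Notation leb := (@lebesgue_measure R).
Local Notation lnorm2 := (norm2 leb setT).
Implicit Types (u v : R -> R).

(** Its value is 1, as (1 - cos w) / w^2 has integral pi over the line. *)
Definition plancherel_cst : R := kappa / pi.

Lemma plancherel_cst_gt0 : 0 < plancherel_cst.
Proof. by rewrite divr_gt0 ?kappa_gt0 ?pi_gt0. Qed.

Definition spectral_energy u : \bar R := (\int[leb]_w (spectrum u w)%:E)%E.

Lemma spectral_energy_ge0 u : (0 <= spectral_energy u)%E.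
Proof. by apply: integral_ge0 => x _; rewrite lee_fin spectrum_ge0. Qed.

Lemma spectral_energy_sub_le u v : leb.-integrable setT (EFin \o u) ->
  leb.-integrable setT (EFin \o v) ->
  (spectral_energy v <= 2%:E * spectral_energy u + 2%:E * spectral_energy (fun x => u x - v x)%R)%E.
Proof.
move=> iu iv; have iuv := integrableB measurableT iu iv.
have mS f : leb.-integrable setT (EFin \o f) -> measurable_fun setT (fun w => (spectrum f w)%:E).
  by move=> i; apply/measurable_EFinP; exact: spectrum_measurable.
rewrite /spectral_energy -!ge0_integralZl//; try exact: mS;
  try by move=> x _; rewrite lee_fin spectrum_ge0.
rewrite -ge0_integralD//; first last.
- by apply: measurable_funeM => //; exact: mS.
- by move=> x _; rewrite mule_ge0// lee_fin// spectrum_ge0.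
- by apply: measurable_funeM => //; exact: mS.
- by move=> x _; rewrite mule_ge0// lee_fin// spectrum_ge0.
apply: ge0_le_integral => //.
- by move=> x _; rewrite lee_fin spectrum_ge0.
- exact: mS.
- by apply: emeasurable_funD; apply: measurable_funeM; exact: mS.
move=> w _; rewrite -!EFinM -EFinD lee_fin /spectrum.
rewrite !oscB//; [|exact: continuous_sin|exact: sin_max|exact: continuous_cos|exact: cos_max].
set a := osc cos u w; set b := osc cos v w; set c := osc sin u w; set e := osc sin v w.
have := sqr_ge0 (2 * a - b); have := sqr_ge0 (2 * c - e); nra.
Qed.

Lemma osc_near (tr u v : R -> R) (e : R) w : continuous tr -> (forall x, `|tr x| <= 1) ->
  leb.-integrable setT (EFin \o u) -> leb.-integrable setT (EFin \o v) ->
  (\int[leb]_x (`|u x - v x|)%:E <= e%:E)%E -> `|osc tr u w - osc tr v w| <= e.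
Proof.
move=> ctr tr1 iu iv uve; have iuv := integrableB measurableT iu iv.
rewrite -oscB//; apply: le_trans (osc_le ctr tr1 w iuv) _.
rewrite -lee_fin /Rintegral fineK// ge0_fin_numE; last exact: integral_ge0.
by rewrite (le_lt_trans uve)// ltry.
Qed.

(** Fatou's lemma along step functions converging to [u]: their transforms converge
pointwise because the L1 distance tends to 0. *)
Lemma spectral_energy_le u : leb.-integrable setT (EFin \o u) -> step_approx u ->
  (spectral_energy u <= (2 * plancherel_cst)%:E * lnorm2 u)%E.
Proof.
move=> iu [mu au]; apply: (@lee_addMgt0P _ _ _ (2 * plancherel_cst)) => e e0.
have ek k : 0 < Num.min e k.+1%:R^-1 by rewrite lt_min e0 invr_gt0 ltr0n.
have [s /all_and2[s1 s2]] := choice (fun k => au _ (ek k)).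
have is_ k := @stepf_integrable R (s k).
have ms k := @stepf_measurable R (s k).
have oc tr w : continuous tr -> (forall x, `|tr x| <= 1) ->
    (fun k => osc tr (stepf (s k)) w) @ \oo --> osc tr u w.
  move=> ctr tr1; apply/cvgrPdist_le => d d0; near=> k.
  apply: (@le_trans _ _ k.+1%:R^-1).
    apply: osc_near => //; apply: le_trans (s1 k) _.
    by rewrite lee_fin ge_min lexx orbT.
  by apply/ltW; near: k; exact: near_infty_natSinv_lt (PosNum d0).
have -> : spectral_energy u = (\int[leb]_w limn_einf (fun k => (spectrum (stepf (s k)) w)%:E))%E.
  apply: eq_integral => w _; apply/esym.
  apply: (cvg_limn_einf_sup _).1; apply: cvg_EFin; first exact: nearW.
  rewrite /spectrum; apply: cvgD; apply: cvgM; apply: oc;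
    [exact: continuous_cos|exact: cos_max|exact: continuous_cos|exact: cos_max|
     exact: continuous_sin|exact: sin_max|exact: continuous_sin|exact: sin_max].
apply: le_trans (fatou leb measurableT _ _) _.
- by move=> k; apply/measurable_EFinP; exact: spectrum_measurable.
- by move=> k w _; rewrite lee_fin spectrum_ge0.
apply: limn_einf_le => k; rewrite plancherel_stepf.
have p0 := plancherel_cst_gt0.
apply: (@le_trans _ _ (plancherel_cst%:E * (2%:E * lnorm2 u + 2%:E * e%:E))%E).
  apply: lee_wpmul2l; first by rewrite lee_fin ltW.
  have h : (lnorm2 (stepf (s k)) <= 2%:E * lnorm2 (fun x => stepf (s k) x - u x)%R
    + 2%:E * lnorm2 u)%E.
    have -> : lnorm2 (stepf (s k)) = lnorm2 (fun x => (stepf (s k) x - u x) + u x).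
      by apply: eq_integral => x _; rewrite subrK.
    by apply: norm2D_le => //; exact: measurable_funB (ms k) mu.
  apply: le_trans h _; rewrite addeC leeD2l// lee_pmul2l// norm2_subC.
  by apply: le_trans (s2 k) _; rewrite lee_fin ge_min lexx.
rewrite ge0_muleDr ?mule_ge0 ?norm2_ge0 ?lee_fin ?(ltW e0)//.
by rewrite !muleA -!EFinM (mulrC plancherel_cst 2).
Unshelve. all: by end_near. Qed.

(** Near a step function, for which equality holds, the error is controlled by the
upper bound applied to the difference. *)
Lemma spectral_energy_ge u : leb.-integrable setT (EFin \o u) -> step_approx u ->
  (plancherel_cst%:E * lnorm2 u <= 4%:E * spectral_energy u)%E.
Proof.
move=> iu [mu au]; apply: (@lee_addMgt0P _ _ _ (10 * plancherel_cst)) => e e0.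
have [s [s1 s2]] := au e e0.
have is_ := @stepf_integrable R s.
have ms := @stepf_measurable R s.
have p0 := plancherel_cst_gt0.
have iuv := integrableB measurableT iu is_.
have a : step_approx (fun x => u x - stepf s x).
  split; first exact: measurable_funB.
  move=> e' e'0; have [s' [s1' s2']] := au e' e'0.
  have [s'' E] := stepfB s' s; exists s''; rewrite E.
  have F x : u x - stepf s x - (stepf s' x - stepf s x) = u x - stepf s' x by ring.
  by split; [under eq_integral do rewrite F|rewrite /norm2; under eq_integral do rewrite F].
have h1 : (lnorm2 u <= 2%:E * lnorm2 (fun x => u x - stepf s x)%R + 2%:E * lnorm2 (stepf s))%E.
  have -> : lnorm2 u = lnorm2 (fun x => (u x - stepf s x) + stepf s x).
    by apply: eq_integral => x _; rewrite subrK.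
  by apply: norm2D_le => //; exact: measurable_funB.
have h2 := spectral_energy_sub_le iu is_.
have h3 := spectral_energy_le iuv a.
have h4 : (plancherel_cst%:E * lnorm2 (stepf s) <= 2%:E * spectral_energy u
  + (4 * plancherel_cst * e)%:E)%E.
  rewrite -plancherel_stepf; apply: le_trans h2 _; apply: leeD2l.
  apply: (@le_trans _ _ (2%:E * ((2 * plancherel_cst)%:E * e%:E))%E).
    rewrite lee_pmul2l//; apply: le_trans h3 _.
    by rewrite lee_pmul2l// lte_fin mulr_gt0.
  by rewrite -!EFinM lee_fin; lra.
apply: (@le_trans _ _ (plancherel_cst%:E * (2%:E * e%:E)
  + 2%:E * (plancherel_cst%:E * lnorm2 (stepf s)))%E).
  apply: le_trans (lee_wpmul2l _ h1) _; first by rewrite lee_fin ltW.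
  rewrite ge0_muleDr ?mule_ge0 ?norm2_ge0// leeD//.
    by rewrite lee_pmul2l// lee_pmul2l.
  by rewrite muleCA.
apply: (@le_trans _ _ (plancherel_cst%:E * (2%:E * e%:E) + 2%:E * (2%:E * spectral_energy u
  + (4 * plancherel_cst * e)%:E))%E).
  by rewrite leeD2l// lee_pmul2l.
have B : (0 <= (4 * plancherel_cst * e)%:E)%E.
  by rewrite lee_fin mulr_ge0 ?(ltW e0)// mulr_ge0// ltW.
rewrite ge0_muleDr ?mule_ge0 ?spectral_energy_ge0// (muleA 2%:E 2%:E) -!EFinM addeCA -EFinD.
have -> : 2 * 2 = 4 :> R by ring.
by rewrite leeD2l// lee_fin; lra.
Qed.

End real_frame_bounds.

(** * Squared norms of complex functions *)

Section complex_square_norm.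
Local Open Scope complex_scope.
Context {R : realType}.
Implicit Types z : R[i].

Definition csq z : R := complex.Re z ^+ 2 + complex.Im z ^+ 2.

Lemma sqrt_measurable : measurable_fun setT (@Num.sqrt R).
Proof. by apply: continuous_measurable_fun; exact: sqrt_continuous. Qed.

Lemma csq_ge0 z : 0 <= csq z.
Proof. by rewrite addr_ge0// sqr_ge0. Qed.

Lemma csq0 : csq 0 = 0.
Proof. by rewrite /csq /= expr0n addr0. Qed.

Lemma normr_csq z : complex.Re `|z| = Num.sqrt (csq z).
Proof. by rewrite normc_def. Qed.

Lemma normr_le_csq z1 z2 : `|z1| <= `|z2| -> csq z1 <= csq z2.
Proof.
by rewrite !normc_def lecR ler_sqrt// csq_ge0.
Qed.

Lemma csqM z1 z2 : csq (z1 * z2) = csq z1 * csq z2.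
Proof. by case: z1 z2 => [a b] [c e]; rewrite /csq/=; ring. Qed.

Lemma csqD_le z1 z2 : csq (z1 + z2) <= 2 * csq z1 + 2 * csq z2.
Proof.
case: z1 z2 => [a b] [c e]; rewrite /csq/=.
by have := sqr_ge0 (a - c); have := sqr_ge0 (b - e); nra.
Qed.

Lemma csqN z : csq (- z) = csq z.
Proof. by case: z => a b; rewrite /csq/= !sqrrN. Qed.

Lemma csqJ z : csq z^* = csq z.
Proof. by case: z => a b; rewrite /csq/= sqrrN. Qed.

Context d (T : measurableType d).
Variables (mu : {measure set T -> \bar R}) (D : set T).
Hypothesis mD : measurable D.
Implicit Types f g : T -> R[i].

Definition cnorm2 f : \bar R := (\int[mu]_(x in D) (csq (f x))%:E)%E.

Lemma cnorm2_ge0 f : (0 <= cnorm2 f)%E.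
Proof. by apply: integral_ge0 => x _; rewrite lee_fin csq_ge0. Qed.

Lemma csq_measurable f : cmeasurable_fun D f ->
  measurable_fun D (fun x => csq (f x)).
Proof. by move=> [mr mi]; apply: measurable_funD; apply: measurable_funX. Qed.

Lemma ecsq_measurable f : cmeasurable_fun D f ->
  measurable_fun D (fun x => (csq (f x))%:E).
Proof. by move=> mf; apply/measurable_EFinP; exact: csq_measurable. Qed.

Lemma csq_integrable f : cmeasurable_fun D f -> (cnorm2 f < +oo)%E ->
  mu.-integrable D (EFin \o (fun x => csq (f x))).
Proof.
move=> mf fy; apply/integrableP; split; first exact: ecsq_measurable.
by under eq_integral do rewrite /= ger0_norm ?csq_ge0//.
Qed.

Lemma cnorm2_norm2 f : cmeasurable_fun D f ->
  (cnorm2 f = norm2 mu D (fun x => complex.Re (f x)) + norm2 mu D (fun x => complex.Im (f x)))%E.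
Proof.
move=> [mr mi]; rewrite /norm2 -ge0_integralD//.
- by move=> x _; rewrite lee_fin sqr_ge0.
- exact: measurable_sqr.
- by move=> x _; rewrite lee_fin sqr_ge0.
- exact: measurable_sqr.
Qed.

Lemma cLnormE f : cLnorm mu D 2 f = sqrte (cnorm2 f).
Proof.
rewrite /cLnorm unlock /= poweR12_sqrt; last first.
  by apply: integral_ge0 => x _; exact: poweR_ge0.
congr sqrte; rewrite /cnorm2 [in RHS]integral_mkcond; apply: eq_integral => x _.
rewrite !patchE; case: ifPn => _; last by rewrite abse0 poweR0r// pnatr_eq0.
have -> : Normc.normc (f x) = Num.sqrt (csq (f x)) by case: (f x).
rewrite gee0_abs ?lee_fin ?sqrtr_ge0// poweR_EFin.
by rewrite powR_mulrn ?sqrtr_ge0// sqr_sqrtr// csq_ge0.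
Qed.

Lemma cLfun2P f : cLfun mu D 2 f <-> cmeasurable_fun D f /\ (cnorm2 f < +oo)%E.
Proof.
rewrite /cLfun cLnormE; split => -[mf fy]; split => //.
  by have := cnorm2_ge0 f; move: fy; case: (cnorm2 f) => //= r _ _; exact: ltry.
by move: fy; have := cnorm2_ge0 f; case: (cnorm2 f) => //= r _ _; exact: ltry.
Qed.

Lemma cLnorm_le f g (M : R) : 0 <= M ->
  (cLnorm mu D 2 f <= M%:E * cLnorm mu D 2 g)%E ->
  (cnorm2 f <= (M ^+ 2)%:E * cnorm2 g)%E.
Proof.
move=> M0; rewrite !cLnormE.
have -> : (M%:E * sqrte (cnorm2 g) = sqrte ((M ^+ 2)%:E * cnorm2 g))%E.
  by rewrite sqrteM ?lee_fin ?sqr_ge0//= sqrtr_sqr ger0_norm.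
by rewrite lee_sqrt// mule_ge0 ?cnorm2_ge0// lee_fin sqr_ge0.
Qed.

Lemma cLnorm_cvg0 (h : nat -> T -> R[i]) :
  cLnorm mu D 2 (h k) @[k --> \oo] --> 0%E <-> cnorm2 (h k) @[k --> \oo] --> 0%E.
Proof.
have E f e : (0 <= e)%R -> (cLnorm mu D 2 f <= e%:E)%E = (cnorm2 f <= (e ^+ 2)%:E)%E.
  move=> e0; have -> : e%:E = sqrte (e ^+ 2)%:E by rewrite /= sqrtr_sqr ger0_norm.
  by rewrite cLnormE lee_sqrt// lee_fin sqr_ge0.
split => h0; apply: cvge0P.
- by move=> k; exact: cnorm2_ge0.
- move=> e e0; have := cvge0_lt h0 (_ : 0 < Num.sqrt e).
  rewrite sqrtr_gt0 => /(_ e0)[N _ H]; exists N => // k Nk /=.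
  by rewrite -(sqr_sqrtr (ltW e0)) -E ?sqrtr_ge0// ltW// H.
- by move=> k; rewrite cLnormE sqrte_ge0.
- move=> e e0; have := cvge0_lt h0 (_ : 0 < e ^+ 2).
  rewrite exprn_gt0// => /(_ isT)[N _ H]; exists N => // k Nk /=.
  by rewrite E ?(ltW e0)// ltW// H.
Qed.

Lemma cmeasurable_funD f g : cmeasurable_fun D f -> cmeasurable_fun D g ->
  cmeasurable_fun D (fun x => f x + g x).
Proof.
move=> [fr fi] [gr gi]; split; [rewrite (_ : (fun x => _) =
  (fun x => complex.Re (f x) + complex.Re (g x)))|rewrite (_ : (fun x => _) =
  (fun x => complex.Im (f x) + complex.Im (g x)))]; do ?exact: measurable_funD;
  by apply/funext => x; case: (f x) (g x) => [a b] [c e].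
Qed.

Lemma cmeasurable_funM f g : cmeasurable_fun D f -> cmeasurable_fun D g ->
  cmeasurable_fun D (fun x => f x * g x).
Proof.
move=> [fr fi] [gr gi]; split; [rewrite (_ : (fun x => _) =
  (fun x => complex.Re (f x) * complex.Re (g x) - complex.Im (f x) * complex.Im (g x)))
  |rewrite (_ : (fun x => _) =
  (fun x => complex.Re (f x) * complex.Im (g x) + complex.Im (f x) * complex.Re (g x)))].
- by apply: measurable_funB; exact: measurable_funM.
- by apply/funext => x; case: (f x) (g x) => [a b] [c e].
- by apply: measurable_funD; exact: measurable_funM.
- by apply/funext => x; case: (f x) (g x) => [a b] [c e].
Qed.

Lemma cmeasurable_cst z : cmeasurable_fun D (fun=> z).
Proof. by split; exact: measurable_cst. Qed.

Lemma cmeasurable_funN f : cmeasurable_fun D f -> cmeasurable_fun D (fun x => - f x).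
Proof.
move=> mf; rewrite (_ : (fun x => - f x) = (fun x => -1 * f x)).
  by apply: cmeasurable_funM => //; exact: cmeasurable_cst.
by apply/funext => x; rewrite mulN1r.
Qed.

Lemma cmeasurable_funB f g : cmeasurable_fun D f -> cmeasurable_fun D g ->
  cmeasurable_fun D (fun x => f x - g x).
Proof. by move=> mf mg; apply: cmeasurable_funD => //; exact: cmeasurable_funN. Qed.

Lemma cnorm2_le_ae f g : cmeasurable_fun D f -> cmeasurable_fun D g ->
  {ae mu, forall x, D x -> csq (f x) <= csq (g x)} -> (cnorm2 f <= cnorm2 g)%E.
Proof.
move=> mf mg fg; apply: ae_ge0_le_integral => //.
- by move=> x _; rewrite lee_fin csq_ge0.
- exact: ecsq_measurable.
- by move=> x _; rewrite lee_fin csq_ge0.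
- exact: ecsq_measurable.
Qed.

Lemma cnorm2D_le f g : cmeasurable_fun D f -> cmeasurable_fun D g ->
  (cnorm2 (fun x => f x + g x)%R <= 2%:E * cnorm2 f + 2%:E * cnorm2 g)%E.
Proof.
move=> mf mg; rewrite /cnorm2 -!ge0_integralZl//; first last.
- by move=> x _; rewrite lee_fin csq_ge0.
- exact: ecsq_measurable.
- by move=> x _; rewrite lee_fin csq_ge0.
- exact: ecsq_measurable.
rewrite -ge0_integralD//; first last.
- by apply: measurable_funeM; exact: ecsq_measurable.
- by move=> x _; rewrite mule_ge0// lee_fin// csq_ge0.
- by apply: measurable_funeM; exact: ecsq_measurable.
- by move=> x _; rewrite mule_ge0// lee_fin// csq_ge0.
apply: ge0_le_integral => //.
- by move=> x _; rewrite lee_fin csq_ge0.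
- by apply: ecsq_measurable; exact: cmeasurable_funD.
- by apply: emeasurable_funD; apply: measurable_funeM; exact: ecsq_measurable.
by move=> x _; rewrite -!EFinM -EFinD lee_fin csqD_le.
Qed.

Lemma cnorm2B_le f g h : cmeasurable_fun D f -> cmeasurable_fun D g -> cmeasurable_fun D h ->
  (cnorm2 (fun x => f x - h x)%R <=
   2%:E * cnorm2 (fun x => f x - g x)%R + 2%:E * cnorm2 (fun x => g x - h x)%R)%E.
Proof.
move=> mf mg mh.
rewrite (_ : (fun x => f x - h x) = (fun x => (f x - g x) + (g x - h x))).
  by apply: cnorm2D_le; exact: cmeasurable_funB.
by apply/funext => x; rewrite addrA subrK.
Qed.

Lemma cnorm2BC f g : cnorm2 (fun x => f x - g x) = cnorm2 (fun x => g x - f x).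
Proof. by apply: eq_integral => x _; rewrite -csqN opprB. Qed.

Lemma cnorm2Z z f : cmeasurable_fun D f ->
  (cnorm2 (fun x => z * f x)%R = (csq z)%:E * cnorm2 f)%E.
Proof.
move=> mf; rewrite /cnorm2 -ge0_integralZl//.
- by apply: eq_integral => x _; rewrite csqM EFinM.
- exact: ecsq_measurable.
- by move=> x _; rewrite lee_fin csq_ge0.
- by rewrite lee_fin csq_ge0.
Qed.

Lemma cLfun1_integrable f : cLfun mu D 1 f ->
  mu.-integrable D (EFin \o (fun x => complex.Re (f x))) /\
  mu.-integrable D (EFin \o (fun x => complex.Im (f x))).
Proof.
move=> [[mr mi]]; rewrite /cLnorm Lnorm1 => fy.
have i : mu.-integrable D (EFin \o (fun x => Num.sqrt (csq (f x)))).
  apply/integrableP; split.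
    apply/measurable_EFinP; apply: measurableT_comp; first exact: sqrt_measurable.
    by apply: csq_measurable.
  rewrite integral_mkcond; move: fy; congr (_ < _)%E; apply: eq_integral => x _; rewrite !patchE.
  by case: ifPn => _; rewrite ?abse0// normr_csq.
by split; apply: (integrable_of_bound mD _ i) => // x Dx;
  rewrite -sqrtr_sqr ler_sqrt ?csq_ge0// /csq ?lerDl ?lerDr sqr_ge0.
Qed.

Lemma cLfun1P f : cmeasurable_fun D f ->
  mu.-integrable D (EFin \o (fun x => complex.Re (f x))) ->
  mu.-integrable D (EFin \o (fun x => complex.Im (f x))) -> cLfun mu D 1 f.
Proof.
move=> mf ir ii; split=> //; rewrite /cLnorm Lnorm1.
have := integrable_lty mD (integrableD mD (integrable_abse ir) (integrable_abse ii)).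
apply: le_lt_trans; rewrite [leRHS]integral_mkcond.
have mr : measurable_fun setT ((fun x => complex.Re (f x)) \_ D).
  by apply/(measurable_restrictT _ mD); case: mf.
apply: ge0_le_integral => //.
- apply: measurableT_comp => //; apply/(measurable_restrictT _ mD).
  apply/measurable_EFinP; under eq_fun do rewrite normr_csq.
  by apply: measurableT_comp; [exact: sqrt_measurable|exact: csq_measurable].
- apply/(measurable_restrictT _ mD); apply: emeasurable_funD.
    by apply: measurableT_comp => //; apply/measurable_EFinP; case: mf.
  by apply: measurableT_comp => //; apply/measurable_EFinP; case: mf.
move=> x _; rewrite !patchE; case: ifPn => _; last by rewrite abse0.
rewrite normr_csq /= ger0_norm ?sqrtr_ge0// -EFinD lee_fin.
rewrite -[leRHS]ger0_norm ?addr_ge0// -sqrtr_sqr ler_sqrt ?sqr_ge0//.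
rewrite sqrrD !real_normK ?num_real// /csq -addrA lerD2l lerDr.
by rewrite mulrn_wge0// mulr_ge0.
Qed.

End complex_square_norm.

(** * Completeness of L2 *)

Section riesz_fischer.
Context d (T : measurableType d) (R : realType).
Variable mu : {measure set T -> \bar R}.
Local Notation lnorm2 := (norm2 mu setT).

(** The increments are bounded by a geometric sequence of ratio 1/2. *)
Lemma geometric_increments_cvg (v : nat -> R) (A : R) :
  (forall i, (4 ^+ i) * (v i.+1 - v i) ^+ 2 <= A) -> cvgn v.
Proof.
move=> H; have A0 : 0 <= A.
  by rewrite (le_trans _ (H 0%N))// expr0 mul1r sqr_ge0.
have -> : v = (fun n => v 0%N + series (telescope v) n).
  by apply/funext => n; rewrite -eq_sum_telescope.
apply: is_cvgD; first exact: is_cvg_cst.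
apply: normed_cvg.
apply: (@series_le_cvg _ _ (geometric (Num.sqrt A) 2^-1)).
- by move=> n /=.
- by move=> n; rewrite /geometric/= mulr_ge0 ?sqrtr_ge0// exprn_ge0// invr_ge0.
- move=> n; rewrite /telescope/geometric/= exprVn ler_pdivlMr ?exprn_gt0//.
  rewrite -ler_sqr ?nnegrE ?mulr_ge0 ?sqrtr_ge0// ?exprn_ge0//.
  rewrite exprMn sqr_sqrtr// real_normK ?num_real// -exprM mulnC exprM mulrC.
  by have -> : 2 ^+ 2 = 4 :> R by [rewrite expr2; ring].
- by apply: is_cvg_geometric_series; rewrite ger0_norm ?invr_ge0// invf_lt1// ltr1n.
Qed.

(** The Riesz-Fischer argument: a subsequence with rapidly decreasing increments
converges almost everywhere, and Fatou's lemma compares the sequence with the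
limit.  The limit is defined as an upper limit, which is measurable whether or
not the subsequence converges. *)
Lemma L2_complete (u_ : nat -> T -> R) :
  (forall k, measurable_fun setT (u_ k)) ->
  (forall e : R, 0 < e -> exists N, forall k l, (N <= k)%N -> (N <= l)%N ->
    (lnorm2 (fun x => u_ k x - u_ l x)%R <= e%:E)%E) ->
  exists2 u : T -> R, measurable_fun setT u &
    forall e : R, 0 < e -> exists N, forall k, (N <= k)%N ->
    (lnorm2 (fun x => u_ k x - u x)%R <= e%:E)%E.
Proof.
move=> mu_ cauchy.
(* Small enough for the series of 4^i |v_{i+1} - v_i|^2 to have a finite integral. *)
pose eps i : R := 4 ^- i * (2 ^ i.+1)%:R^-1.
have eps0 i : 0 < eps i by rewrite mulr_gt0// invr_gt0 ?exprn_gt0// ltr0n expn_gt0.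
have [n_ n_P] := choice (fun i => cauchy _ (eps0 i)).
(* A nondecreasing sequence of indices above both [n_] and the identity. *)
pose m_ i := (\sum_(j < i.+1) (n_ j).+1)%N.
have m_n i : (n_ i <= m_ i)%N.
  by rewrite /m_ big_ord_recr/=; apply: leq_trans (leqnSn _) (leq_addl _ _).
have m_S i : (m_ i <= m_ i.+1)%N by rewrite /m_ [leqRHS]big_ord_recr/= leq_addr.
have m_i i : (i <= m_ i)%N.
  elim: i => // i IH; rewrite /m_ big_ord_recr/= -/(m_ i) addnS ltnS.
  exact: leq_trans IH (leq_addr _ _).
pose v i := u_ (m_ i).
have mv i : measurable_fun setT (v i) by exact: mu_.
have dv i : (lnorm2 (fun x => v i.+1 x - v i x)%R <= (eps i)%:E)%E.
  by apply: n_P; [exact: leq_trans (m_n i) (m_S i)|exact: m_n].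
pose G x : \bar R := (\big[+%E/0]_(0 <= i <oo) (4 ^+ i * (v i.+1 x - v i x) ^+ 2)%:E)%E.
have t0 i x : (0 <= (4 ^+ i * (v i.+1 x - v i x) ^+ 2)%:E)%E.
  by rewrite lee_fin mulr_ge0 ?sqr_ge0// exprn_ge0.
have mt i : measurable_fun setT (fun x => (4 ^+ i * (v i.+1 x - v i x) ^+ 2)%:E).
  apply/measurable_EFinP; apply: measurable_funM => //.
  by apply: measurable_funX; exact: measurable_funB.
have G0 x : (0 <= G x)%E by apply: nneseries_ge0 => i _ _.
have mG : measurable_fun setT G by apply: ge0_emeasurable_sum => // i x _ _; exact: t0.
have iG : mu.-integrable setT G.
  apply/integrableP; split=> //.
  under eq_integral do rewrite gee0_abs//.
  rewrite integral_nneseries//.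
  apply: (@le_lt_trans _ _ (\big[+%E/0]_(0 <= i <oo) (0 + (1 / (2 ^ i.+1)%:R)%:E))%E).
    apply: lee_nneseries => [i _ _|i _]; first exact: integral_ge0.
    under eq_integral do rewrite EFinM.
    rewrite ge0_integralZl//; last 2 first.
    - by apply: measurable_sqr; exact: measurable_funB.
    - by move=> x _; rewrite lee_fin sqr_ge0.
    apply: (@le_trans _ _ ((4 ^+ i)%:E * (eps i)%:E)%E).
      by apply: lee_wpmul2l; [rewrite lee_fin exprn_ge0|exact: dv].
    by rewrite -EFinM add0e lee_fin /eps mulrA mulfV ?expf_neq0// !mul1r.
  apply: (@le_lt_trans _ _ (\big[+%E/0%E]_(0 <= i <oo) (0%E : \bar R) + 1%:E)%E).
    exact: epsilon_trick.
  by rewrite eseries0// add0e ltry.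
pose u x : R := fine (limn_esup (fun i => (v i x)%:E)).
have mu' : measurable_fun setT u.
  apply: measurableT_comp => //.
  by apply: measurable_fun_limn_esup => i; exact/measurable_EFinP.
have vu : {ae mu, forall x, v ^~ x @ \oo --> u x}.
  apply: filterS (integrable_ae measurableT iG) => x /(_ I) Gx.
  have cv : cvgn (v ^~ x).
    apply: (@geometric_increments_cvg _ (fine (G x))) => i.
    rewrite -lee_fin fineK//.
    apply: le_trans (nneseries_lim_ge i.+1 _); last by move=> n _ _; exact: t0.
    by rewrite big_nat_recr//= leeDr// sume_ge0.
  rewrite /u (cvg_limn_einf_sup (_ : _ --> (limn (v ^~ x))%:E)).2//=.
  by apply: cvg_EFin => //; exact: nearW.
exists u => // e e0.
have [N NP] := cauchy e e0; exists N => k Nk.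
have mB i : measurable_fun setT (fun x => ((u_ k x - v (i + N)%N x) ^+ 2)%:E).
  by apply: measurable_sqr; exact: measurable_funB.
apply: (@le_trans _ _ (\int[mu]_x limn_einf (fun i => ((u_ k x - v (i + N)%N x) ^+ 2)%:E))%E).
  apply: ae_ge0_le_integral => //.
  - by move=> x _; rewrite lee_fin sqr_ge0.
  - by apply: measurable_sqr; exact: measurable_funB.
  - move=> x _; rewrite limn_einf_lim; apply: lime_ge; first exact: is_cvg_einfs.
    apply: nearW => n; apply/ereal_infP => _ /= [i _ <-].
    by rewrite lee_fin sqr_ge0.
  - rewrite /limn_einf; apply: measurableT_comp => //.
    apply: measurable_fun_limn_esup => i; exact: measurableT_comp.
  apply: filterS vu => x vux _.
  rewrite (cvg_limn_einf_sup (_ : _ --> ((u_ k x - u x) ^+ 2)%:E)).1//.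
  apply: cvg_EFin; first exact: nearW.
  have vN : (fun i => v (i + N)%N x) @ \oo --> u x by rewrite (cvg_shiftn N (v ^~ x)).
  by apply: cvgM; apply: cvgB => //; exact: cvg_cst.
apply: le_trans (fatou mu measurableT mB _) _.
  by move=> i x _; rewrite lee_fin sqr_ge0.
apply: limn_einf_le => i; apply: NP => //.
exact: leq_trans (leq_addl _ _) (m_i _).
Qed.

End riesz_fischer.

(** * The Fourier integral of a complex function *)

Section complex_integral.
Context d (T : measurableType d) (R : realType).
Variables (mu : {measure set T -> \bar R}) (D : set T).
Hypothesis mD : measurable D.
Local Notation Re := complex.Re.
Local Notation Im := complex.Im.
Implicit Types f g : T -> R[i].

Definition cintegrable f := mu.-integrable D (EFin \o (fun x => Re (f x))) /\
  mu.-integrable D (EFin \o (fun x => Im (f x))).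

Lemma cintegrable_measurable f : cintegrable f -> cmeasurable_fun D f.
Proof. by move=> [/integrableP[/measurable_EFinP ? _] /integrableP[/measurable_EFinP ? _]]. Qed.

Lemma cintegrable_lin (a : R[i]) f g : cintegrable f -> cintegrable g ->
  cintegrable (fun x => a * f x + g x) /\
  cintegral mu D (fun x => a * f x + g x) = a * cintegral mu D f + cintegral mu D g.
Proof.
case: a => a b [fr fi] [gr gi].
have RE : (fun x => Re ((a +i* b)%C * f x + g x)) =
    (fun x => (a * Re (f x) + - b * Im (f x)) + Re (g x)).
  by apply/funext => x; case: (f x) (g x) => [? ?] [? ?] /=; rewrite mulNr.
have IE : (fun x => Im ((a +i* b)%C * f x + g x)) =
    (fun x => (a * Im (f x) + b * Re (f x)) + Im (g x)).
  by apply/funext => x; case: (f x) (g x) => [? ?] [? ?].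
have i1 := integrableZl mD a fr; have i2 := integrableZl mD (- b) fi.
have i3 := integrableZl mD a fi; have i4 := integrableZl mD b fr.
have i12 := integrableD mD i1 i2; have i34 := integrableD mD i3 i4.
rewrite /cintegrable RE IE; split; first by
  split; [exact: (integrableD mD i12 gr)|exact: (integrableD mD i34 gi)].
rewrite /cintegral RE IE !RintegralD// !RintegralZl//.
by apply/eqP; rewrite eq_complex/= mulNr !eqxx.
Qed.

Lemma cintegrable_sum (I : eqType) (s : seq I) (a : I -> R[i]) (f : I -> T -> R[i]) :
  (forall i, i \in s -> cintegrable (f i)) ->
  cintegrable (fun x => \sum_(i <- s) a i * f i x) /\
  cintegral mu D (fun x => \sum_(i <- s) a i * f i x) =
    \sum_(i <- s) a i * cintegral mu D (f i).
Proof.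
elim: s => [_|i s IH fi].
  have -> : (fun x => \sum_(i <- [::]) a i * f i x) = (fun=> 0).
    by apply/funext => x; rewrite big_nil.
  split; first by split; exact: integrable0.
  by rewrite big_nil /cintegral /Rintegral !integral0.
have -> : (fun x => \sum_(j <- i :: s) a j * f j x) =
    (fun x => a i * f i x + \sum_(j <- s) a j * f j x).
  by apply/funext => x; rewrite big_cons.
have [IH1 IH2] := IH (fun j js => fi j (@mem_behead _ (i :: s) j js)).
have [H1 H2] := cintegrable_lin (a i) (fi i (mem_head i s)) IH1.
by split => //; rewrite H2 IH2 big_cons.
Qed.

Lemma cintegrableB f g : cintegrable f -> cintegrable g ->
  cintegrable (fun x => f x - g x) /\
  cintegral mu D (fun x => f x - g x) = cintegral mu D f - cintegral mu D g.
Proof.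
move=> fi gi; have [] := cintegrable_lin (-1) gi fi.
have -> : (fun x => -1 * g x + f x) = (fun x => f x - g x).
  by apply/funext => x; rewrite mulN1r addrC.
by move=> H1 H2; split => //; rewrite H2 mulN1r addrC.
Qed.

End complex_integral.

Section complex_fourier.
Context {R : realType}.
Local Notation leb := (@lebesgue_measure R).
Local Notation Re := complex.Re.
Local Notation Im := complex.Im.
Local Notation lcnorm2 := (cnorm2 leb setT).
Implicit Types f g : R -> R[i].

Local Notation cintegrable := (cintegrable leb setT).

Lemma ReM_expi f (w x : R) : Re (f x * expi (- (2 * pi * w * x))) =
  Re (f x) * cos (2 * pi * w * x) + Im (f x) * sin (2 * pi * w * x).
Proof. by case: (f x) => a b; rewrite /expi cosN sinN /=; ring. Qed.

Lemma ImM_expi f (w x : R) : Im (f x * expi (- (2 * pi * w * x))) =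
  Im (f x) * cos (2 * pi * w * x) - Re (f x) * sin (2 * pi * w * x).
Proof. by case: (f x) => a b; rewrite /expi cosN sinN /=; ring. Qed.

Let cc := @continuous_cos R.
Let cs := @continuous_sin R.
Let c1 := @cos_max R.
Let s1 := @sin_max R.

Lemma Re_fourier f w : cintegrable f -> Re (fourier_integral f w) =
  osc cos (fun x => Re (f x)) w + osc sin (fun x => Im (f x)) w.
Proof.
move=> [ir ii]; rewrite /fourier_integral /cintegral /= /osc.
rewrite -RintegralD//; [|exact: osc_integrable|exact: osc_integrable].
by apply: eq_Rintegral => x _; exact: ReM_expi.
Qed.

Lemma Im_fourier f w : cintegrable f -> Im (fourier_integral f w) =
  osc cos (fun x => Im (f x)) w - osc sin (fun x => Re (f x)) w.
Proof.
move=> [ir ii]; rewrite /fourier_integral /cintegral /= /osc.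
rewrite -RintegralB//; [|exact: osc_integrable|exact: osc_integrable].
by apply: eq_Rintegral => x _; exact: ImM_expi.
Qed.

Lemma cintegrable_expi f w : cintegrable f ->
  cintegrable (fun x => f x * expi (- (2 * pi * w * x))).
Proof.
move=> [fr fi]; split.
  have -> : EFin \o (fun x : R => Re (f x * expi (- (2 * pi * w * x)))) =
      ((EFin \o (fun x => (Re (f x) * cos (2 * pi * w * x))%R)) \+
       (EFin \o (fun x => (Im (f x) * sin (2 * pi * w * x))%R)))%E.
    by apply/funext => x; rewrite /= -EFinD ReM_expi.
  by apply: integrableD => //; exact: osc_integrable.
have -> : EFin \o (fun x : R => Im (f x * expi (- (2 * pi * w * x)))) =
    (fun x => (EFin \o (fun x => (Im (f x) * cos (2 * pi * w * x))%R)) x -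
     (EFin \o (fun x => (Re (f x) * sin (2 * pi * w * x))%R)) x)%E.
  by apply/funext => x; rewrite /= -EFinB ImM_expi.
by apply: integrableB => //; exact: osc_integrable.
Qed.

Lemma fourier_integralB f g w : cintegrable f -> cintegrable g ->
  fourier_integral (fun x => f x - g x) w = fourier_integral f w - fourier_integral g w.
Proof.
move=> cf cg; rewrite /fourier_integral.
rewrite -(cintegrableB _ (cintegrable_expi w cf) (cintegrable_expi w cg)).2//.
by congr cintegral; apply/funext => x; rewrite mulrBl.
Qed.

Lemma fourier_integral_sum (I : eqType) (s : seq I) (a : I -> R[i]) (f : I -> R -> R[i]) w :
  (forall i, i \in s -> cintegrable (f i)) ->
  fourier_integral (fun x => \sum_(i <- s) a i * f i x) w =
  \sum_(i <- s) a i * fourier_integral (f i) w.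
Proof.
move=> fi; rewrite /fourier_integral.
rewrite -(cintegrable_sum measurableT a (fun i si => cintegrable_expi w (fi i si))).2//.
by congr cintegral; apply/funext => x; rewrite mulr_suml; apply: eq_bigr => i _; rewrite mulrA.
Qed.

Lemma fourier_measurable f : cintegrable f -> cmeasurable_fun setT (fourier_integral f).
Proof.
move=> cf; have [fr fi] := cf; split.
  under eq_fun do rewrite Re_fourier//.
  by apply: measurable_funD; exact: osc_measurable.
under eq_fun do rewrite Im_fourier//.
by apply: measurable_funB; exact: osc_measurable.
Qed.

Lemma osc_cosN (u : R -> R) w : osc cos u (- w) = osc cos u w.
Proof. by apply: eq_Rintegral => x _; rewrite mulrN mulNr cosN. Qed.

Lemma osc_sinN (u : R -> R) w : leb.-integrable setT (EFin \o u) ->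
  osc sin u (- w) = - osc sin u w.
Proof.
move=> iu; rewrite -[RHS]mulN1r -oscZ//; apply: eq_Rintegral => x _.
by rewrite mulrN mulNr sinN; ring.
Qed.

(** For f = u + i v the cross terms between u and v change sign with w. *)
Lemma csq_fourier_sym f w : cintegrable f ->
  csq (fourier_integral f w) + csq (fourier_integral f (- w)) =
  2 * (spectrum (fun x => Re (f x)) w + spectrum (fun x => Im (f x)) w).
Proof.
move=> cf; have [fr fi] := cf.
rewrite /csq !Re_fourier// !Im_fourier// !osc_cosN !osc_sinN// /spectrum.
ring.
Qed.

Lemma integral_symmetrize (A B : R -> R) :
  measurable_fun setT A -> (forall w, 0 <= A w) ->
  measurable_fun setT B -> (forall w, 0 <= B w) ->
  (forall w, A w + A (- w) = 2 * B w) ->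
  (\int[leb]_w (A w)%:E = \int[leb]_w (B w)%:E)%E.
Proof.
move=> mA A0 mB B0 AB.
have mE : measurable_fun setT (EFin \o A) by exact/measurable_EFinP.
have mN : measurable_fun setT (fun w : R => (A (- w))%:E).
  by apply: (measurableT_comp mE); exact: oppr_measurable.
have A0E w : (0 <= (EFin \o A) w)%E by rewrite lee_fin.
have sym : (\int[leb]_w (A w)%:E = \int[leb]_w (A (- w))%:E)%E.
  have N0 : -1 != 0 :> R by rewrite oppr_eq0 oner_eq0.
  have := ge0_integral_scale N0 mE A0E; rewrite normrN1 mul1e => ->.
  by apply: eq_integral => w _; rewrite /= mulN1r.
have D : (2%:E * (\int[leb]_w (A w)%:E) = 2%:E * (\int[leb]_w (B w)%:E))%E.
  rewrite mule_natl mule2n {2}sym -ge0_integralD//; last by move=> w _; rewrite lee_fin.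
    rewrite -ge0_integralZl//; last 2 first.
    - exact/measurable_EFinP.
    - by move=> w _; rewrite lee_fin.
    by apply: eq_integral => w _; rewrite -EFinD AB.
  by move=> w _; rewrite lee_fin.
exact: mule2_inj D.
Qed.

(** By [csq_fourier_sym], as Lebesgue measure is invariant under w -> - w. *)
Lemma cnorm2_fourier f : cintegrable f -> lcnorm2 (fourier_integral f) =
  (spectral_energy (fun x => Re (f x)) + spectral_energy (fun x => Im (f x)))%E.
Proof.
move=> cf; have [fr fi] := cf.
have mr := spectrum_measurable fr; have mi := spectrum_measurable fi.
rewrite /spectral_energy -ge0_integralD//; first last.
- exact/measurable_EFinP.
- by move=> w _; rewrite lee_fin spectrum_ge0.
- exact/measurable_EFinP.
- by move=> w _; rewrite lee_fin spectrum_ge0.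
apply: integral_symmetrize.
- exact: csq_measurable (fourier_measurable cf).
- by move=> w; exact: csq_ge0.
- exact: measurable_funD.
- by move=> w; rewrite addr_ge0// spectrum_ge0.
- by move=> w; exact: csq_fourier_sym.
Qed.

Lemma L2_parts f : cmeasurable_fun setT f -> (lcnorm2 f < +oo)%E ->
  (norm2 leb setT (fun x => Re (f x)) < +oo)%E /\
  (norm2 leb setT (fun x => Im (f x)) < +oo)%E.
Proof.
move=> mf; rewrite cnorm2_norm2// => fy; split; apply: le_lt_trans fy.
  by rewrite leeDl// norm2_ge0.
by rewrite leeDr// norm2_ge0.
Qed.

Lemma cnorm2_fourier_le f : cintegrable f -> (lcnorm2 f < +oo)%E ->
  (lcnorm2 (fourier_integral f) <= (2 * plancherel_cst)%:E * lcnorm2 f)%E.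
Proof.
move=> cf fy; have mf := cintegrable_measurable cf; have [fr fi] := cf.
have [ry iy] := L2_parts mf fy; have p0 := @plancherel_cst_gt0 R.
rewrite cnorm2_fourier// cnorm2_norm2// ge0_muleDr ?norm2_ge0//.
by apply: leeD; apply: spectral_energy_le => //; exact: step_approx_L1L2.
Qed.

Lemma cnorm2_fourier_ge f : cintegrable f -> (lcnorm2 f < +oo)%E ->
  (plancherel_cst%:E * lcnorm2 f <= 4%:E * lcnorm2 (fourier_integral f))%E.
Proof.
move=> cf fy; have mf := cintegrable_measurable cf; have [fr fi] := cf.
have [ry iy] := L2_parts mf fy.
rewrite (cnorm2_fourier cf) cnorm2_norm2//.
rewrite [leLHS]ge0_muleDr ?norm2_ge0// [leRHS]ge0_muleDr ?spectral_energy_ge0//.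
by apply: leeD; apply: spectral_energy_ge => //; exact: step_approx_L1L2.
Qed.

End complex_fourier.

(** * Truncation to a window *)

Section truncation.
Context {R : realType}.
Local Notation leb := (@lebesgue_measure R).
Local Notation Re := complex.Re.
Local Notation Im := complex.Im.
Local Notation lcnorm2 := (cnorm2 leb setT).
Local Notation cintegrable := (cintegrable leb setT).
Implicit Types f g h : R -> R[i].

Definition window (n : nat) : set R := `[- n%:R, n%:R]%classic.

Lemma measurable_window n : measurable (window n).
Proof. exact: measurable_itv. Qed.

Lemma window_length n : leb (window n) = (2 * n%:R)%:E.
Proof.
rewrite /window lebesgue_measure_itv/= lte_fin -EFinD; case: ltP => [_|n0].
  by congr EFin; rewrite opprK mulr_natl mulr2n.
have -> : n%:R = 0 :> R.
  by apply/le_anti; rewrite ler0n andbT; have := ler0n R n; lra.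
by rewrite mulr0.
Qed.

Definition trunc f (n : nat) (x : R) : R[i] := if x \in window n then f x else 0.

Lemma truncB f g n x : trunc (fun y => f y - g y) n x = trunc f n x - trunc g n x.
Proof. by rewrite /trunc; case: ifPn; rewrite ?subr0. Qed.

Lemma trunc_measurable f n : cmeasurable_fun setT f -> cmeasurable_fun setT (trunc f n).
Proof.
move=> [mr mi]; split.
  rewrite (_ : (fun x => _) = (fun x => Re (f x)) \_ (window n)).
    by apply/(measurable_restrictT _ (measurable_window n)); exact: measurable_funTS.
  by apply/funext => x; rewrite patchE /trunc; case: ifPn.
rewrite (_ : (fun x => _) = (fun x => Im (f x)) \_ (window n)).
  by apply/(measurable_restrictT _ (measurable_window n)); exact: measurable_funTS.
by apply/funext => x; rewrite patchE /trunc; case: ifPn.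
Qed.

Lemma csq_trunc_le f n x : csq (trunc f n x) <= csq (f x).
Proof. by rewrite /trunc; case: ifPn => // _; rewrite csq0 csq_ge0. Qed.

Lemma csq_tail_le f n x : csq (f x - trunc f n x) <= csq (f x).
Proof.
by rewrite /trunc; case: ifPn => _; rewrite ?subrr ?subr0// csq0 csq_ge0.
Qed.

Lemma cnorm2_le f g : cmeasurable_fun setT f -> cmeasurable_fun setT g ->
  (forall x, csq (f x) <= csq (g x)) -> (lcnorm2 f <= lcnorm2 g)%E.
Proof. by move=> mf mg fg; apply: cnorm2_le_ae => //; apply: aeW. Qed.

Lemma cnorm2_trunc_le f n : cmeasurable_fun setT f -> (lcnorm2 (trunc f n) <= lcnorm2 f)%E.
Proof.
move=> mf; apply: cnorm2_le => //; first exact: trunc_measurable.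
by move=> x; exact: csq_trunc_le.
Qed.

Lemma cnorm2_trunc_integral f n : cmeasurable_fun setT f ->
  lcnorm2 (trunc f n) = (\int[leb]_(x in window n) (csq (f x))%:E)%E.
Proof.
move=> mf; rewrite [RHS]integral_mkcond; apply: eq_integral => x _.
by rewrite patchE /trunc; case: ifPn => // _; rewrite csq0.
Qed.

Lemma integrable_window n : leb.-integrable setT (EFin \o \1_(window n)).
Proof. exact: integrable_indic_itv. Qed.

(** An L2 function is integrable on a bounded window, since |a| <= a^2 + 1. *)
Lemma trunc_cintegrable f n : cmeasurable_fun setT f -> (lcnorm2 f < +oo)%E ->
  cintegrable (trunc f n).
Proof.
move=> mf fy; have i := integrableD measurableT (@csq_integrable R _ _ leb setT _ mf fy)
  (integrable_window n).
have [mr mi] := trunc_measurable n mf.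
have B (a b : R) : `|a| <= (a ^+ 2 + b ^+ 2) + 1.
  rewrite -lerBlDr; have := sqr_ge0 (`|a| - 1); have := sqr_ge0 b.
  by rewrite sqrrB1 real_normK ?num_real//; have := normr_ge0 a; lra.
split; apply: (integrable_of_bound measurableT _ i) => // x _ /=;
  rewrite /trunc indicE; case: ifPn => _ /=; rewrite ?normr0 ?addr0 ?csq_ge0//;
  case: (f x) => a b; rewrite /csq/=; first exact: B.
by rewrite (addrC (a ^+ 2)); exact: B.
Qed.

Lemma cnorm2_tail_cvg0 f : cmeasurable_fun setT f -> (lcnorm2 f < +oo)%E ->
  lcnorm2 (fun x => f x - trunc f n x) @[n --> \oo] --> 0%E.
Proof.
move=> mf fy; have i := @csq_integrable R _ _ leb setT _ mf fy.
have := @dominated_cvg _ _ _ leb setT measurableT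
  (fun n x => (csq (f x - trunc f n x))%:E) (fun=> 0%E) _ _ _ _ i.
rewrite integral0; apply => //.
- move=> n; apply: ecsq_measurable; apply: cmeasurable_funB => //.
  exact: trunc_measurable.
- move=> x _; apply: cvg_near_cst; near=> n.
  rewrite /trunc (_ : x \in window n) ?subrr ?csq0//.
  rewrite inE /window/= in_itv/= -ler_norml; near: n; exact: nbhs_infty_ger.
- move=> n x _; rewrite /= ger0_norm ?csq_ge0// lee_fin; exact: csq_tail_le.
Unshelve. all: by end_near. Qed.

Lemma tail_dominated f g n : cmeasurable_fun setT f -> cmeasurable_fun setT g ->
  {ae leb, forall x, csq (f x) <= csq (g x)} ->
  (lcnorm2 (fun x => f x - trunc f n x)%R <= lcnorm2 (fun x => g x - trunc g n x)%R)%E.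
Proof.
move=> mf mg fg; apply: cnorm2_le_ae => //.
- by apply: cmeasurable_funB => //; exact: trunc_measurable.
- by apply: cmeasurable_funB => //; exact: trunc_measurable.
apply: ae_imp fg => x fgx _; rewrite /trunc; case: ifPn => _.
  by rewrite !subrr.
by rewrite !subr0.
Qed.

(** Passing from one truncation to a larger one adds at most the tail. *)
Lemma csq_trunc2_le f k n x : (n <= k)%N ->
  csq (trunc f k x - trunc f n x) <= csq (f x - trunc f n x).
Proof.
move=> nk; have [xk|xk] := boolP (x \in window k); first by rewrite /trunc xk.
have xn : x \notin window n.
  apply: contra xk; rewrite !inE /window/= !in_itv/= => /andP[x1 x2].
  have nk' : n%:R <= k%:R :> R by rewrite ler_nat.
  by rewrite (le_trans _ x1) ?lerN2// (le_trans x2).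
by rewrite /trunc (negbTE xk) (negbTE xn) subrr csq0 csq_ge0.
Qed.

End truncation.

(** * The Fourier transform on L2 *)

Section fourier_L2_existence.
Context {R : realType}.
Local Notation leb := (@lebesgue_measure R).
Local Notation Re := complex.Re.
Local Notation Im := complex.Im.
Local Notation lcnorm2 := (cnorm2 leb setT).
Local Notation cintegrable := (cintegrable leb setT).
Local Notation fou := (@fourier_integral R).
Implicit Types f g h : R -> R[i].

Lemma cnorm2_fourierB_le f g : cintegrable f -> cintegrable g ->
  (lcnorm2 f < +oo)%E -> (lcnorm2 g < +oo)%E ->
  (lcnorm2 (fun w => fou f w - fou g w)%R
    <= (2 * plancherel_cst)%:E * lcnorm2 (fun x => f x - g x)%R)%E.
Proof.
move=> cf cg fy gy.
have mf := cintegrable_measurable cf; have mg := cintegrable_measurable cg.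
rewrite (_ : (fun w => fou f w - fou g w) = fou (fun x => f x - g x)); last first.
  by apply/funext => w; rewrite fourier_integralB.
apply: cnorm2_fourier_le; first by have [] := cintegrableB measurableT cf cg.
apply: (@le_lt_trans _ _ (2%:E * lcnorm2 f + 2%:E * lcnorm2 (fun x => - g x)%R)%E).
  by apply: cnorm2D_le => //; exact: cmeasurable_funN.
rewrite lte_add_pinfty// lte_mul_pinfty//.
by rewrite /cnorm2; under eq_integral do rewrite csqN.
Qed.

Lemma fourier_trunc_cauchy f : cmeasurable_fun setT f -> (lcnorm2 f < +oo)%E ->
  forall e : R, 0 < e -> exists N, forall k l, (N <= k)%N -> (N <= l)%N ->
    (lcnorm2 (fun w => fou (trunc f k) w - fou (trunc f l) w)%R <= e%:E)%E.
Proof.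
move=> mf fy e e0; have p0 := @plancherel_cst_gt0 R.
have mt n := trunc_measurable n mf.
have ty n : (lcnorm2 (trunc f n) < +oo)%E by exact: le_lt_trans (cnorm2_trunc_le n mf) fy.
have d0 : 0 < e / (8 * plancherel_cst) :> R by rewrite divr_gt0// mulr_gt0.
have [N _ HN] := cvge0_lt (cnorm2_tail_cvg0 mf fy) d0.
exists N => k l Nk Nl.
apply: le_trans (cnorm2_fourierB_le (trunc_cintegrable k mf fy) (trunc_cintegrable l mf fy)
  (ty k) (ty l)) _.
apply: (@le_trans _ _ ((2 * plancherel_cst)%:E * (2%:E * (e / (8 * plancherel_cst))%:E
  + 2%:E * (e / (8 * plancherel_cst))%:E))%E).
  apply: lee_wpmul2l; first by rewrite lee_fin mulr_ge0// ltW.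
  apply: le_trans (cnorm2B_le leb measurableT (mt k) mf (mt l)) _.
  apply: leeD; rewrite lee_pmul2l//; last exact/ltW/HN.
  by rewrite cnorm2BC; exact/ltW/HN.
rewrite [leLHS](_ : _ = (2 * plancherel_cst * (2 * (e / (8 * plancherel_cst))
  + 2 * (e / (8 * plancherel_cst))))%:E)//.
by rewrite lee_fin le_eqVlt; apply/orP; left; apply/eqP; field; rewrite gt_eqF.
Qed.

(** The limit of the transforms of the truncations of [f]; any other sequence of
L1 and L2 functions converging to [f] has transforms close to these. *)
Lemma fourier_L2_ex f : cLfun leb setT 2 f -> exists F, is_fourier_L2 f F.
Proof.
move=> /cLfun2P[mf fy]; have p0 := @plancherel_cst_gt0 R.
have mt n := trunc_measurable n mf.
have ct n := trunc_cintegrable n mf fy.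
have ty n : (lcnorm2 (trunc f n) < +oo)%E by exact: le_lt_trans (cnorm2_trunc_le n mf) fy.
have mF n := fourier_measurable (ct n).
have Fy n : (lcnorm2 (fou (trunc f n)) < +oo)%E.
  apply: le_lt_trans (cnorm2_fourier_le (ct n) (ty n)) _.
  by rewrite lte_mul_pinfty// lee_fin mulr_ge0// ltW.
have cauchy := fourier_trunc_cauchy mf fy.
have mB k l := cmeasurable_funB (mF k) (mF l).
have csplit k l := cnorm2_norm2 leb measurableT (mB k l).
have [U mU HU] : exists2 U : R -> R, measurable_fun setT U &
    forall e : R, 0 < e -> exists N, forall k, (N <= k)%N ->
    (norm2 leb setT (fun w => Re (fou (trunc f k) w) - U w)%R <= e%:E)%E.
  apply: (@L2_complete _ _ R leb (fun k w => Re (fou (trunc f k) w))) => [k|e e0];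
    first by case: (mF k).
  have [N HN] := cauchy e e0; exists N => k l Nk Nl.
  apply: le_trans (HN k l Nk Nl); rewrite csplit.
  have -> : (fun x => Re (fou (trunc f k) x) - Re (fou (trunc f l) x)) =
      (fun x => Re (fou (trunc f k) x - fou (trunc f l) x)).
    by apply/funext => x; case: (fou (trunc f k) x) (fou (trunc f l) x) => [? ?] [? ?].
  by rewrite leeDl// norm2_ge0.
have [V mV HV] : exists2 V : R -> R, measurable_fun setT V &
    forall e : R, 0 < e -> exists N, forall k, (N <= k)%N ->
    (norm2 leb setT (fun w => Im (fou (trunc f k) w) - V w)%R <= e%:E)%E.
  apply: (@L2_complete _ _ R leb (fun k w => Im (fou (trunc f k) w))) => [k|e e0];
    first by case: (mF k).
  have [N HN] := cauchy e e0; exists N => k l Nk Nl.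
  apply: le_trans (HN k l Nk Nl); rewrite csplit.
  have -> : (fun x => Im (fou (trunc f k) x) - Im (fou (trunc f l) x)) =
      (fun x => Im (fou (trunc f k) x - fou (trunc f l) x)).
    by apply/funext => x; case: (fou (trunc f k) x) (fou (trunc f l) x) => [? ?] [? ?].
  by rewrite leeDr// norm2_ge0.
pose F w : R[i] := (U w +i* V w)%C.
have mFF : cmeasurable_fun setT F by [].
have HF e : 0 < e -> exists N, forall k, (N <= k)%N ->
    (lcnorm2 (fun w => fou (trunc f k) w - F w)%R <= e%:E)%E.
  move=> e0; have e2 : 0 < e / 2 by rewrite divr_gt0.
  have [N1 H1] := HU _ e2; have [N2 H2] := HV _ e2.
  exists (maxn N1 N2) => k; rewrite geq_max => /andP[k1 k2].
  rewrite (cnorm2_norm2 leb measurableT (cmeasurable_funB (mF k) mFF)) [e]splitr EFinD.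
  apply: leeD.
    apply: le_trans (H1 k k1); rewrite le_eqVlt; apply/orP; left; apply/eqP.
    by congr norm2; apply/funext => w; rewrite /F; case: (fou (trunc f k) w).
  apply: le_trans (H2 k k2); rewrite le_eqVlt; apply/orP; left; apply/eqP.
  by congr norm2; apply/funext => w; rewrite /F; case: (fou (trunc f k) w).
exists F; split.
  apply/cLfun2P; split => //.
  have [N HN] := HF 1 ltr01.
  apply: (@le_lt_trans _ _ (2%:E * lcnorm2 (fun w => F w - fou (trunc f N) w)%R
    + 2%:E * lcnorm2 (fou (trunc f N)))%E).
    have E : F = (fun w => (F w - fou (trunc f N) w) + fou (trunc f N) w).
      by apply/funext => w; rewrite subrK.
    rewrite {1}E; exact: (cnorm2D_le leb measurableT (cmeasurable_funB mFF (mF N)) (mF N)).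
  rewrite lte_add_pinfty// lte_mul_pinfty// cnorm2BC.
  by apply: le_lt_trans (HN N (leqnn N)) _; exact: ltry.
move=> h Hh /cLnorm_cvg0 hf; apply/cLnorm_cvg0; apply: cvge0P => [k|e e0].
  exact: cnorm2_ge0.
have ch k : cintegrable (h k) by have [/(cLfun1_integrable measurableT)] := Hh k.
have hy k : (lcnorm2 (h k) < +oo)%E by have [_ /cLfun2P[]] := Hh k.
have mh k := cintegrable_measurable (ch k).
have e4 : 0 < e / 4 by rewrite divr_gt0.
have d0 : 0 < e / (32 * plancherel_cst) :> R by rewrite divr_gt0// mulr_gt0.
have [N1 H1] := HF _ e4.
have [N2 _ H2] := cvge0_lt (cnorm2_tail_cvg0 mf fy) d0.
have [N3 _ H3] := cvge0_lt hf d0.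
exists N3 => // k Nk /=; set j := maxn N1 N2.
apply: le_trans (cnorm2B_le leb measurableT (fourier_measurable (ch k)) (mF j) mFF) _.
apply: (@le_trans _ _ (2%:E * ((2 * plancherel_cst)%:E * (2%:E * (e / (32 * plancherel_cst))%:E
  + 2%:E * (e / (32 * plancherel_cst))%:E)) + 2%:E * (e / 4)%:E)%E).
  apply: leeD; rewrite lee_pmul2l//; last by apply: H1; rewrite leq_maxl.
  apply: le_trans (cnorm2_fourierB_le (ch k) (ct j) (hy k) (ty j)) _.
  apply: lee_wpmul2l; first by rewrite lee_fin mulr_ge0// ltW.
  apply: le_trans (cnorm2B_le leb measurableT (mh k) mf (mt j)) _.
  apply: leeD; rewrite lee_pmul2l//; first exact/ltW/H3.
  by apply/ltW/H2; rewrite /= leq_maxr.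
rewrite [leLHS](_ : _ = (2 * (2 * plancherel_cst * (2 * (e / (32 * plancherel_cst))
  + 2 * (e / (32 * plancherel_cst)))) +
  2 * (e / 4))%:E)//.
by rewrite lee_fin le_eqVlt; apply/orP; left; apply/eqP; field; rewrite gt_eqF.
Qed.

Lemma fourier_L2P f : cLfun leb setT 2 f -> is_fourier_L2 f (fourier_L2 f).
Proof.
move=> /fourier_L2_ex[F HF].
by rewrite /fourier_L2; case: xgetP => [G _ //|/(_ F)].
Qed.

(** The upper norm bound passes to the transform on L2, as the limit of the bounds
for the larger truncations. *)
Lemma fourier_L2_trunc f n : cLfun leb setT 2 f ->
  cmeasurable_fun setT (fourier_L2 f) /\
  (lcnorm2 (fun w => fourier_L2 f w - fou (trunc f n) w)%R <=
   (4 * plancherel_cst)%:E * lcnorm2 (fun x => f x - trunc f n x)%R)%E.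
Proof.
move=> f2; have [/cLfun2P[mF _] HF] := fourier_L2P f2; split => //.
have /cLfun2P[mf fy] := f2; have p0 := @plancherel_cst_gt0 R.
have mt k := trunc_measurable k mf.
have ct k := trunc_cintegrable k mf fy.
have ty k : (lcnorm2 (trunc f k) < +oo)%E by exact: le_lt_trans (cnorm2_trunc_le k mf) fy.
have : cLnorm leb setT 2 (fun w => fou (trunc f k) w - fourier_L2 f w) @[k --> \oo] --> 0%E.
  apply: (HF (trunc f)) => [k|].
    split; last by apply/cLfun2P; split; [exact: mt|exact: ty].
    by have [ctr cti] := ct k; exact: (@cLfun1P R _ _ leb setT measurableT _ (mt k) ctr cti).
  apply/cLnorm_cvg0; have := cnorm2_tail_cvg0 mf fy.
  by under eq_fun do rewrite cnorm2BC.
move=> /cLnorm_cvg0 H; apply: (@lee_addMgt0P _ _ _ 2) => e e0.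
have [N _ HN] := cvge0_lt H e0.
set k := maxn N n.
apply: le_trans (cnorm2B_le leb measurableT mF (fourier_measurable (ct k))
  (fourier_measurable (ct n))) _.
rewrite addeC; apply: leeD.
  have -> : 4 * plancherel_cst = 2 * (2 * plancherel_cst) :> R by ring.
  rewrite EFinM -muleA lee_pmul2l//.
  apply: le_trans (cnorm2_fourierB_le (ct k) (ct n) (ty k) (ty n)) _.
  apply: lee_wpmul2l; first by rewrite lee_fin mulr_ge0// ltW.
  apply: cnorm2_le; do ?exact: cmeasurable_funB.
  by move=> x; apply: csq_trunc2_le; rewrite leq_maxr.
rewrite EFinM lee_pmul2l// cnorm2BC; apply/ltW/HN.
by rewrite /= leq_maxl.
Qed.

End fourier_L2_existence.

(** * Inequalities for Riesz sequences *)

Section riesz_bounds.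
Context d (T : measurableType d) (R : realType).
Variables (mu : {measure set T -> \bar R}) (D : set T).
Hypothesis mD : measurable D.
Local Notation Re := complex.Re.
Local Notation Im := complex.Im.
Local Notation L2 := (cLfun mu D 2).
Implicit Types f g : T -> R[i].

Lemma L2_lin (a : R[i]) f g : L2 f -> L2 g -> L2 (fun x => a * f x + g x).
Proof.
move=> /cLfun2P[mf fy] /cLfun2P[mg gy].
have maf : cmeasurable_fun D (fun x => a * f x).
  by apply: cmeasurable_funM => //; exact: cmeasurable_cst.
apply/cLfun2P; split; first exact: cmeasurable_funD.
apply: le_lt_trans (cnorm2D_le mu mD maf mg) _.
by rewrite lte_add_pinfty// lte_mul_pinfty// cnorm2Z// lte_mul_pinfty// lee_fin csq_ge0.
Qed.

Lemma L2_zero : L2 (fun=> 0).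
Proof.
apply/cLfun2P; split; first exact: cmeasurable_cst.
by rewrite /cnorm2 integral0_eq// => x _; rewrite csq0.
Qed.

Lemma L2_sum (I : eqType) (s : seq I) (a : I -> R[i]) (u : I -> T -> R[i]) :
  (forall i, i \in s -> L2 (u i)) -> L2 (fun x => \sum_(i <- s) a i * u i x).
Proof.
elim: s => [_|i s IH us].
  rewrite (_ : (fun x => _) = (fun=> 0)); first exact: L2_zero.
  by apply/funext => x; rewrite big_nil.
rewrite (_ : (fun x => _) = (fun x => a i * u i x + \sum_(j <- s) a j * u j x)).
  by apply: L2_lin; [exact/us/mem_head|apply: IH => j js; apply: us; rewrite in_cons js orbT].
by apply/funext => x; rewrite big_cons.
Qed.

(** The two parts of f g^* are bounded by |f|^2 + |g|^2. *)
Lemma L2_mul_cintegrable f g : L2 f -> L2 g ->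
  cintegrable mu D (fun x => f x * (g x)^*%C).
Proof.
move=> /cLfun2P[mf fy] /cLfun2P[mg gy].
have i := integrableD mD (csq_integrable mf fy) (csq_integrable mg gy).
have mgJ : cmeasurable_fun D (fun x => (g x)^*%C).
  have [mr mi] := mg; split.
    by rewrite (_ : (fun x => _) = (fun x => Re (g x)))//; apply/funext => x; case: (g x).
  rewrite (_ : (fun x => _) = (fun x => - Im (g x))).
    exact: measurableT_comp.
  by apply/funext => x; case: (g x).
have [mr mi] := cmeasurable_funM mf mgJ.
split; apply: (integrable_of_bound mD _ i) => // x Dx /=;
  case: (f x) (g x) => [a b] [c e]; rewrite /csq/= ler_norml.
  have := sqr_ge0 (a - c); have := sqr_ge0 (b - e).
  have := sqr_ge0 (a + c); have := sqr_ge0 (b + e); nra.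
have := sqr_ge0 (a - e); have := sqr_ge0 (b - c).
have := sqr_ge0 (a + e); have := sqr_ge0 (b + c); nra.
Qed.

Lemma cnorm2_L2inner f : L2 f -> cnorm2 mu D f = (Re (L2inner mu D f f))%:E.
Proof.
move=> f2; have [ir _] := L2_mul_cintegrable f2 f2.
rewrite /L2inner /cintegral /= /Rintegral fineK; last exact: integrable_fin_num.
apply: eq_integral => x _; congr EFin; case: (f x) => a b; rewrite /csq/=; ring.
Qed.

Lemma cnorm2_orthonormal_sum (s : seq nat) (a : nat -> R[i]) (e : nat -> T -> R[i]) :
  uniq s -> (forall n, n \in s -> L2 (e n)) ->
  (forall n m, n \in s -> m \in s -> L2inner mu D (e n) (e m) = (n == m)%:R) ->
  cnorm2 mu D (fun x => \sum_(n <- s) a n * e n x) = (\sum_(n <- s) csq (a n))%:E.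
Proof.
move=> us e2 eo; set F := fun x => _.
have F2 : L2 F by exact: L2_sum.
rewrite cnorm2_L2inner//; congr EFin.
have right n : n \in s -> L2inner mu D (e n) F = (a n)^*%C.
  move=> ns; rewrite /L2inner.
  have -> : (fun x => e n x * (F x)^*%C) =
      (fun x => \sum_(m <- s) (a m)^*%C * (e n x * (e m x)^*%C)).
    apply/funext => x; rewrite /F rmorph_sum/= mulr_sumr; apply: eq_bigr => m _.
    by rewrite rmorphM/= mulrCA.
  rewrite (cintegrable_sum mD _ _).2; last first.
    by move=> m ms; apply: L2_mul_cintegrable; exact: e2.
  rewrite (bigD1_seq n)//= [X in _ * X](eo n n)// eqxx mulr1 big_seq_cond big1 ?addr0//.
  move=> m /andP[ms mn]; rewrite [X in _ * X](eo n m)//.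
  by rewrite eq_sym (negbTE mn) mulr0.
have -> : L2inner mu D F F = \sum_(n <- s) a n * (a n)^*%C.
  rewrite {1}/L2inner.
  have -> : (fun x => F x * (F x)^*%C) =
      (fun x => \sum_(n <- s) a n * (e n x * (F x)^*%C)).
    apply/funext => x; rewrite {1}/F mulr_suml; apply: eq_bigr => n _.
    by rewrite mulrA.
  rewrite (cintegrable_sum mD _ _).2; last first.
    by move=> n ns; apply: L2_mul_cintegrable => //; exact: e2.
  by apply: eq_big_seq => n ns; congr (_ * _); exact: right.
rewrite raddf_sum/=; apply: eq_bigr => n _.
by case: (a n) => b c; rewrite /csq/=; ring.
Qed.

(** Operators act on representatives, so linearity holds almost everywhere only. *)
Lemma bounded_linear_sum U (s : seq nat) (a : nat -> R[i]) (u : nat -> T -> R[i]) :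
  bounded_linear_L2 mu D U -> (forall n, n \in s -> L2 (u n)) ->
  {ae mu, forall x, D x -> U (fun y => \sum_(n <- s) a n * u n y) x =
    \sum_(n <- s) a n * U (u n) x}.
Proof.
move=> [_ linU _]; elim: s => [_|n s IH us].
  (* Linearity with coefficient -1 at 0 gives U 0 = - U 0 + U 0 almost everywhere. *)
  have := linU (-1) _ _ L2_zero L2_zero.
  rewrite (_ : (fun x => -1 * 0 + 0) = (fun x => \sum_(n <- [::]) a n * u n x)).
    rewrite (_ : (fun=> 0) = (fun x => \sum_(n <- [::]) a n * u n x)).
      by apply: ae_imp => x H Dx; rewrite H// big_nil mulN1r addNr.
    by apply/funext => x; rewrite big_nil.
  by apply/funext => x; rewrite big_nil mulr0 addr0.
have us' m : m \in s -> L2 (u m) by move=> ms; apply: us; rewrite in_cons ms orbT.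
rewrite (_ : (fun y => _) = (fun x => a n * u n x + \sum_(j <- s) a j * u j x)); last first.
  by apply/funext => x; rewrite big_cons.
apply: filterS2 (linU (a n) _ _ (us n (mem_head _ _)) (L2_sum a us')) (IH us') => x H1 H2 Dx.
by rewrite H1// H2// big_cons.
Qed.

Lemma bounded_linear_cnorm2 U : bounded_linear_L2 mu D U ->
  exists2 M : R, 0 < M & forall f, L2 f -> (cnorm2 mu D (U f) <= M%:E * cnorm2 mu D f)%E.
Proof.
move=> [_ _ [M HM]]; exists ((`|M| + 1) ^+ 2); first by rewrite exprn_gt0// ltr_wpDl.
move=> f f2; apply: cLnorm_le; first by rewrite addr_ge0.
apply: le_trans (HM f f2) _; apply: lee_wpmul2r; first by rewrite cLnormE sqrte_ge0.
by rewrite lee_fin (le_trans (ler_norm _))// lerDl.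
Qed.

(** The upper bound is that of the inverse operator on an orthonormal expansion;
the lower one comes from the boundedness of the operator itself. *)
Lemma Riesz_seq_bounds J (u : nat -> T -> R[i]) : Riesz_seq mu D J u ->
  exists m M : R, [/\ 0 < m, 0 < M,
    forall n, J n -> (m%:E <= cnorm2 mu D (u n))%E &
    forall (s : seq nat) (a : nat -> R[i]), uniq s -> (forall n, n \in s -> J n) ->
      (cnorm2 mu D (fun x => \sum_(n <- s) a n * u n x)%R <=
       (M * \sum_(n <- s) csq (a n))%:E)%E].
Proof.
move=> [u2 [U [V [bU bV VU _ [e2 eo]]]]].
have [MU MU0 HU] := bounded_linear_cnorm2 bU.
have [MV MV0 HV] := bounded_linear_cnorm2 bV.
exists MU^-1, MV; split=> [||n Jn|s a us sJ] //; first by rewrite invr_gt0.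
  have : cnorm2 mu D (U (u n)) = 1%:E.
    by rewrite cnorm2_L2inner ?eo ?eqxx//; exact: e2.
  move: (HU _ (u2 n Jn)) => /[swap] ->.
  by rewrite -lee_pdivrMl// mule1.
have s2 n : n \in s -> cLfun mu D 2 (u n) by move=> /sJ; exact: u2.
have se2 n : n \in s -> cLfun mu D 2 (U (u n)) by move=> /sJ; exact: e2.
set F := fun x => _; have F2 : L2 F by exact: L2_sum.
have [UL _ _] := bU; have [VL _ _] := bV.
have UF2 := UL _ F2; have VUF2 := VL _ UF2.
have [/cLfun2P[mF _] /cLfun2P[mUF _] /cLfun2P[mVUF _]] := And3 F2 UF2 VUF2.
apply: (@le_trans _ _ (cnorm2 mu D (V (U F)))).
  by apply: cnorm2_le_ae => //; apply: ae_imp (VU _ F2) => x H Dx; rewrite H.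
apply: le_trans (HV _ UF2) _; rewrite EFinM; apply: lee_wpmul2l; first by rewrite lee_fin ltW.
rewrite -(cnorm2_orthonormal_sum _ us se2); last by move=> n m /sJ Jn /sJ Jm; exact: eo.
apply: cnorm2_le_ae => //; first by have /cLfun2P[] := L2_sum a se2.
by apply: ae_imp (bounded_linear_sum a bU s2) => x H Dx; rewrite H.
Qed.

Lemma orthonormal_Riesz J (u : nat -> T -> R[i]) :
  orthonormal_seq mu D J u -> Riesz_seq mu D J u.
Proof.
move=> [u2 uo]; split => //; exists id, id.
have bid : bounded_linear_L2 mu D id.
  split => //; first by move=> a f g _ _; apply: aeW.
  by exists 1 => f _; rewrite mul1e.
by split => // f _; apply: aeW.
Qed.

End riesz_bounds.

(** * From the Haar measure to the line *)

Section haar_transport.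
Context {R : realType}.
Local Notation leb := (@lebesgue_measure R).
Local Notation haar := (@haar R).

Lemma RposE (x : R) : Rpos x = (0 < x).
Proof. by rewrite /Rpos /= in_itv/= andbT. Qed.

Lemma measurable_Rpos : measurable (@Rpos R).
Proof. exact: measurable_itv. Qed.

Lemma ln_measurable : measurable_fun setT (fun x : R => (ln x : measurableTypeR R)).
Proof. exact: measurable_ln. Qed.

Lemma haar_exp_itv (a b : R) : a < b ->
  (\int[leb]_(r in `]expR a, expR b]) (r^-1)%:E = (b - a)%:E)%E.
Proof.
move=> ab; have eab : expR a < expR b by rewrite ltr_expR.
have pos (x : R) : x \in `[expR a, expR b] -> 0 < x.
  by rewrite in_itv/= => /andP[ax _]; rewrite (lt_le_trans (expR_gt0 a)).
have mI : measurable_fun `]expR a, expR b] (fun r : R => (r^-1)%:E).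
  by apply/measurable_EFinP; exact: inv_measurable.
rewrite integral_itv_obnd_cbnd//.
rewrite (@continuous_FTC2 _ _ (@ln R))//.
- by rewrite !expRK.
- apply: continuous_in_subspaceT => x; rewrite inE/= => /pos x0.
  by apply: inv_continuous; rewrite gt_eqF.
- split.
  + move=> x xI; apply: ex_derive; apply: is_derive1_ln.
    by apply: pos; exact: subset_itv_oo_cc.
  + by apply: cvg_at_right_filter; apply: continuous_ln; exact: expR_gt0.
  + by apply: cvg_at_left_filter; apply: continuous_ln; exact: expR_gt0.
- move=> x xI; rewrite derive1E; apply: derive_val; apply: is_derive1_ln.
  by apply: pos; exact: subset_itv_oo_cc.
Qed.

Local Notation lnm := (fun x : R => (ln x : measurableTypeR R)).

(** It suffices to compare the two measures on half-open intervals, where the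
Haar measure is an integral of 1/r. *)
Lemma lebesgue_haar (A : set R) : measurable A -> leb A = haar (lnm @^-1` A).
Proof.
move=> mA; rewrite -[RHS]/(pushforward haar lnm A).
have mln := ln_measurable.
apply: lebesgue_measure_unique => // _ [[a b]] _ <-.
rewrite /= /pushforward /Defs.haar.
have -> : lnm @^-1` `]a, b]%classic `&` Rpos = `]expR a, expR b]%classic.
  apply/seteqP; split => r /=; rewrite RposE !in_itv/=.
    move=> [/andP[ar rb] r0].
    by rewrite -[r](@lnK R) ?posrE// ltr_expR ar ler_expR.
  move=> /andP[ar rb]; have r0 : 0 < r by rewrite (lt_trans (expR_gt0 a)).
  by split => //; rewrite -ltr_expR -ler_expR lnK ?posrE// ar.
rewrite lebesgue_measure_itv/= lte_fin; case: ltP => [ab|ba].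
  by rewrite haar_exp_itv.
by rewrite set_itv_ge ?integral_set0// bnd_simp -leNgt ler_expR.
Qed.

Lemma haarC0 : haar (~` Rpos) = 0%E.
Proof. by rewrite /Defs.haar setICl integral_set0. Qed.

Lemma measurable_comp_expR d (T : sigmaRingType d) (h : R -> T) :
  measurable_fun (@Rpos R) h -> measurable_fun setT (fun x => h (expR x)).
Proof.
move=> mh; apply: (measurable_comp measurable_Rpos _ mh).
  by move=> _ [x _ <-]; rewrite RposE expR_gt0.
exact: measurable_expR.
Qed.

Lemma integral_haar (h : R -> \bar R) : measurable_fun (@Rpos R) h ->
  (forall x, (0 <= h x)%E) ->
  (\int[haar]_(x in Rpos) h x = \int[leb]_x h (expR x))%E.
Proof.
move=> mh h0; have mk := measurable_comp_expR mh.
rewrite (@eq_measure_integral _ _ _ _ (pushforward haar lnm));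
  [exact: ln_measurable|move=> mln|by move=> mln A mA _; exact: lebesgue_haar].
rewrite ge0_integral_pushforward// preimage_setT.
rewrite [RHS](@ge0_negligible_integral _ _ _ haar _ (~` Rpos))//; last 4 first.
- exact: measurableC measurable_Rpos.
- by apply: (measurableT_comp mk); exact: ln_measurable.
- by move=> x _; exact: h0.
- exact: haarC0.
rewrite setTD setCK; apply: eq_integral => x; rewrite inE RposE => x0 /=.
by rewrite lnK ?posrE.
Qed.

(** The preimage of a Haar null set under the exponential is Lebesgue null. *)
Lemma ae_haar (P : R -> Prop) : {ae haar, forall x, Rpos x -> P x} ->
  {ae leb, forall x, P (expR x)}.
Proof.
move=> [N [mN N0 PN]]; exists (expR @^-1` N); split.
- by rewrite -[X in measurable X]setTI; exact: measurable_expR.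
- rewrite lebesgue_haar; last first.
    by rewrite -[X in measurable X]setTI; exact: measurable_expR.
  rewrite -[RHS]N0 /Defs.haar; congr (integral _ _ _).
  apply/seteqP; split => x /= [xN x0]; split => //; move: x0 xN; rewrite RposE => x0;
    by rewrite lnK// posrE.
- move=> x /= nP; apply: PN => /= H; apply: nP; apply: H.
  by rewrite RposE expR_gt0.
Qed.

Lemma cmeasurable_haar (f : R -> R[i]) : cmeasurable_fun Rpos f ->
  cmeasurable_fun setT (fun x => f (expR x)).
Proof.
by move=> [mr mi]; split; [exact: (measurable_comp_expR mr)|exact: (measurable_comp_expR mi)].
Qed.

Lemma cnorm2_haar (f : R -> R[i]) : cmeasurable_fun Rpos f ->
  cnorm2 haar Rpos f = cnorm2 leb setT (fun x => f (expR x)).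
Proof.
move=> mf; rewrite /cnorm2; apply: (@integral_haar (fun x => (csq (f x))%:E)).
  exact: ecsq_measurable.
by move=> x; rewrite lee_fin csq_ge0.
Qed.

Lemma cLfun2_haar (f : R -> R[i]) : cLfun haar Rpos 2 f ->
  cLfun leb setT 2 (fun x => f (expR x)).
Proof.
move=> /cLfun2P[mf fy]; apply/cLfun2P; split; first exact: cmeasurable_haar.
by rewrite -cnorm2_haar.
Qed.

End haar_transport.

(** * The umbrella theorem *)

Section umbrella.
Context {R : realType}.
Local Notation leb := (@lebesgue_measure R).
Local Notation Re := complex.Re.
Local Notation Im := complex.Im.
Local Notation lcnorm2 := (cnorm2 leb setT).
Local Notation fou := (@fourier_integral R).
Local Notation L2 := (cLfun leb setT 2).

(** The inequality 2 Re(z e) <= lambda |z|^2 + |e|^2 / lambda, integrated over the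
window, where |e| = 1. *)
Lemma Re_fourier_trunc_le (G : R -> R[i]) (N : nat) (w lambda : R) :
  L2 G -> 0 < lambda ->
  ((Re (fou (trunc G N) w))%:E <=
   (lambda / 2)%:E * lcnorm2 G + (N%:R / lambda)%:E)%E.
Proof.
move=> /cLfun2P[mG Gy] l0.
have cH := trunc_cintegrable N mG Gy.
have [iR _] := cintegrable_expi w cH.
have iG := @csq_integrable R _ _ leb setT _ mG Gy.
have iW := @integrable_window R N.
have i1 := integrableZl measurableT (lambda / 2) iG.
have i2 := integrableZl measurableT ((2 * lambda)^-1) iW.
rewrite /fourier_integral /cintegral /= /Rintegral fineK; last exact: integrable_fin_num.
have -> : ((lambda / 2)%:E * lcnorm2 G + (N%:R / lambda)%:E =
  \int[leb]_x ((lambda / 2)%:E * (csq (G x))%:E + ((2 * lambda)^-1)%:E * (\1_(window N) x)%:E))%E.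
  rewrite integralD// !integralZl// integral_indic//; last exact: measurable_window.
  rewrite setIT; congr (_ + _)%E.
  transitivity (((2 * lambda)^-1)%:E * (2 * N%:R)%:E)%E.
    by rewrite -EFinM; congr EFin; field; rewrite gt_eqF.
  by congr (_ * _)%E; rewrite -window_length.
apply: le_integral => //; first exact: integrableD.
move=> x _; rewrite -!EFinM -EFinD lee_fin ReM_expi /trunc indicE.
have ll : lambda * lambda^-1 = 1 by rewrite mulfV// gt_eqF.
case: ifPn => _; last first.
  by rewrite /= !mul0r addr0 mulr0 addr0 mulr_ge0 ?csq_ge0// divr_ge0// ltW.
rewrite mulr1 /csq; case: (G x) => a b /=.
set t := 2 * pi * w * x; have := cos2Dsin2 t.
move: (cos t) (sin t) => c s cs1.
have -> : (2 * lambda)^-1 = lambda / 2 * ((c / lambda) ^+ 2 + (s / lambda) ^+ 2).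
  by rewrite !exprMn -mulrDl cs1 mul1r; field; rewrite gt_eqF.
have -> : a * c + b * s = lambda / 2 * (2 * (a * (c / lambda)) + 2 * (b * (s / lambda))).
  by field; rewrite gt_eqF.
rewrite -[leRHS]mulrDr ler_pM2l ?divr_gt0//.
have := sqr_ge0 (a - c / lambda); have := sqr_ge0 (b - s / lambda).
move: (c / lambda) (s / lambda) => c' s'; nra.
Qed.

(** By duality: with the conjugates of the transforms at [w] as coefficients, the
sum S to be bounded is the transform at [w] of a truncated combination of the
f_n, whose squared norm is at most M S. *)
Lemma truncated_bessel (f : nat -> R -> R[i]) (s : seq nat) (M : R) (N : nat) w :
  (forall n, n \in s -> L2 (f n)) -> 0 < M ->
  (forall a : nat -> R[i], (lcnorm2 (fun x => \sum_(n <- s) a n * f n x)%R <=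
    (M * \sum_(n <- s) csq (a n))%:E)%E) ->
  \sum_(n <- s) csq (fou (trunc (f n) N) w) <= 2 * N%:R * M.
Proof.
move=> f2 M0 HM.
pose a n := (fou (trunc (f n) N) w)^*%C.
set S := \sum_(n <- s) _.
have aS : \sum_(n <- s) csq (a n) = S by apply: eq_bigr => n _; rewrite /a csqJ.
pose G x := \sum_(n <- s) a n * f n x.
have G2 : L2 G by exact: L2_sum.
have SE : S = Re (fou (trunc G N) w).
  have -> : trunc G N = (fun x => \sum_(n <- s) a n * trunc (f n) N x).
    apply/funext => x; rewrite /trunc /G; case: ifPn => // _.
    by rewrite big1// => n _; rewrite mulr0.
  rewrite fourier_integral_sum; last first.
    by move=> n /f2 /cLfun2P[mf fy]; exact: trunc_cintegrable.
  rewrite raddf_sum; apply: eq_bigr => n _; rewrite /a.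
  by move: (fou _ w) => [b c]; rewrite /csq/=; ring.
(* With lambda = 1 / M the bound reads S <= S / 2 + N M. *)
have Mi : 0 < M^-1 by rewrite invr_gt0.
have := Re_fourier_trunc_le N w G2 Mi; rewrite -SE => H.
have : (S%:E <= (M^-1 / 2)%:E * (M * S)%:E + (N%:R / M^-1)%:E)%E.
  apply: le_trans H _; apply: leeD => //; apply: lee_wpmul2l.
    by rewrite lee_fin divr_ge0// ltW.
  by rewrite -aS; exact: HM.
rewrite -EFinM -EFinD lee_fin invrK.
have -> : M^-1 / 2 * (M * S) = S / 2 by field; rewrite gt_eqF.
lra.
Qed.

(** The energy of [f] is that of its truncation up to a tail, the truncation and its
transform have comparable energies, and outside the frequency window this
transform is close to that of [f], which is small there. *)
Lemma concentration (f : R -> R[i]) (m e1 e2 : R) (N W : nat) :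
  L2 f -> (m%:E <= lcnorm2 f)%E ->
  (lcnorm2 (fun x => f x - trunc f N x)%R <= e1%:E)%E ->
  (lcnorm2 (fun w => fourier_L2 f w - trunc (fourier_L2 f) W w)%R <= e2%:E)%E ->
  ((plancherel_cst * m)%:E <=
    16%:E * lcnorm2 (trunc (fou (trunc f N)) W) + (130 * plancherel_cst * e1 + 32 * e2)%:E)%E.
Proof.
move=> f2 mf1 He1 He2; have /cLfun2P[mf fy] := f2; have p0 := @plancherel_cst_gt0 R.
have [mF HF] := fourier_L2_trunc N f2.
set h := trunc f N in HF *; set F := fourier_L2 f in HF mF He2 *.
have mh : cmeasurable_fun setT h by exact: trunc_measurable.
have hy : (lcnorm2 h < +oo)%E by exact: le_lt_trans (cnorm2_trunc_le N mf) fy.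
have ch : cintegrable leb setT h by exact: trunc_cintegrable.
have mH := fourier_measurable ch.
have mtH := trunc_measurable W mH; have mtF := trunc_measurable W mF.
have mFH := cmeasurable_funB mF mH; have mtFH := trunc_measurable W mFH.
set A := lcnorm2 (trunc (fou h) W).
have A0 : (0 <= A)%E by exact: cnorm2_ge0.
have h1 : (lcnorm2 f <= 2%:E * lcnorm2 h + 2%:E * e1%:E)%E.
  have E : f = (fun x => h x + (f x - h x)) by apply/funext => x; rewrite addrC subrK.
  rewrite {1}E; apply: le_trans (cnorm2D_le leb measurableT mh (cmeasurable_funB mf mh)) _.
  by rewrite leeD2l// lee_pmul2l.
have h2 : (lcnorm2 (fun w => F w - fou h w)%R <= (4 * plancherel_cst * e1)%:E)%E.
  apply: le_trans HF _; rewrite (EFinM (4 * plancherel_cst) e1); apply: lee_wpmul2l => //.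
  by rewrite lee_fin mulr_ge0// ltW.
have h3 : (lcnorm2 (fun w => fou h w - trunc (fou h) W w)%R <=
    2%:E * (4 * plancherel_cst * e1)%:E + 2%:E * e2%:E)%E.
  have E : (fun w => fou h w - trunc (fou h) W w) =
      (fun w => (F w - trunc F W w) + - ((F w - fou h w) - trunc (fun y => F y - fou h y) W w)).
    apply/funext => w; rewrite truncB.
    move: (fou h w) (trunc (fou h) W w) (F w) (trunc F W w) => b c d e.
    by rewrite opprB opprB addrACA [X in _ = _ + X]addrC; ring.
  rewrite E addeC; apply: le_trans (cnorm2D_le leb measurableT _ _) _.
  - exact: cmeasurable_funB.
  - by apply: cmeasurable_funN; exact: cmeasurable_funB.
  apply: leeD; rewrite lee_pmul2l//.
  apply: le_trans h2; apply: cnorm2_le => //.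
    by apply: cmeasurable_funN; exact: cmeasurable_funB.
  by move=> w; rewrite csqN; exact: csq_tail_le.
have h4 : (lcnorm2 (fou h) <= 2%:E * A + 2%:E * (2%:E * (4 * plancherel_cst * e1)%:E
  + 2%:E * e2%:E))%E.
  have E : fou h = (fun w => trunc (fou h) W w + (fou h w - trunc (fou h) W w)).
    by apply/funext => w; rewrite addrC subrK.
  rewrite {1}E; apply: le_trans (cnorm2D_le leb measurableT mtH (cmeasurable_funB mH mtH)) _.
  by rewrite leeD2l// lee_pmul2l.
have h5 := cnorm2_fourier_ge ch hy.
rewrite (EFinM plancherel_cst m);
  apply: (@le_trans _ _ (plancherel_cst%:E * (2%:E * lcnorm2 h + 2%:E * e1%:E))%E).
  apply: lee_wpmul2l; first by rewrite lee_fin ltW.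
  exact: le_trans mf1 h1.
have hfin : lcnorm2 h \is a fin_num by rewrite ge0_fin_numE// cnorm2_ge0.
have Afin : A \is a fin_num.
  rewrite ge0_fin_numE// (le_lt_trans (cnorm2_trunc_le W mH))//.
  by apply: le_lt_trans (cnorm2_fourier_le ch hy) _;
    rewrite lte_mul_pinfty// lee_fin mulr_ge0// ltW.
have : (plancherel_cst%:E * lcnorm2 h <= 4%:E * (2%:E * A
  + 2%:E * (2%:E * (4 * plancherel_cst * e1)%:E + 2%:E * e2%:E)))%E.
  by apply: le_trans h5 _; rewrite lee_pmul2l.
rewrite -(fineK hfin) -(fineK Afin).
move: (fine (lcnorm2 h)) (fine A) => x y.
rewrite -!(EFinM, EFinD) !lee_fin; lra.
Qed.

(** Sum over a finite set of indices the energies of the transforms of the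
truncations in the frequency window: each is bounded below by
[concentration], and the sum is bounded above by [truncated_bessel]. *)
Lemma umbrella_theorem (J : set nat) (f : nat -> R -> R[i]) (phi psi : R -> R[i]) (m M : R) :
  (forall n, L2 (f n)) -> L2 phi -> L2 psi -> 0 < m -> 0 < M ->
  (forall n, J n -> (m%:E <= lcnorm2 (f n))%E) ->
  (forall (s : seq nat) (a : nat -> R[i]), uniq s -> (forall n, n \in s -> J n) ->
    (lcnorm2 (fun x => \sum_(n <- s) a n * f n x)%R <= (M * \sum_(n <- s) csq (a n))%:E)%E) ->
  (forall n, J n -> {ae leb, forall x, csq (f n x) <= csq (phi x)}) ->
  (forall n, J n -> {ae leb, forall w, csq (fourier_L2 (f n) w) <= csq (psi w)}) ->
  finite_set J.
Proof.
move=> f2 /cLfun2P[mphi phiy] /cLfun2P[mpsi psiy] m0 M0 fm HM fphi fpsi.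
have p0 := @plancherel_cst_gt0 R.
(* These tails make the error term of [concentration] equal to half of its
   left-hand side, since 130 / 520 + 32 / 128 = 1 / 2. *)
have e1 : 0 < m / 520 by apply: divr_gt0 m0 _; rewrite ltr0n.
have e2 : 0 < plancherel_cst * m / 128 by apply: divr_gt0 (mulr_gt0 p0 m0) _; rewrite ltr0n.
have [N _ /(_ N (leqnn N)) HN] := cvge0_lt (cnorm2_tail_cvg0 mphi phiy) e1.
have [W _ /(_ W (leqnn W)) HW] := cvge0_lt (cnorm2_tail_cvg0 mpsi psiy) e2.
have mf n : cmeasurable_fun setT (f n) by have /cLfun2P[] := f2 n.
have cf n : cintegrable leb setT (trunc (f n) N).
  by have /cLfun2P[? ?] := f2 n; exact: trunc_cintegrable.
have mH n := fourier_measurable (cf n).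
have lower n : J n -> ((plancherel_cst * m / 32)%:E <= lcnorm2 (trunc (fou (trunc (f n) N)) W))%E.
  move=> Jn; have [mF _] := fourier_L2_trunc N (f2 n).
  have := concentration (f2 n) (fm n Jn)
    (le_trans (tail_dominated N (mf n) mphi (fphi n Jn)) (ltW HN))
    (le_trans (tail_dominated W mF mpsi (fpsi n Jn)) (ltW HW)).
  have := cnorm2_ge0 leb setT (trunc (fou (trunc (f n) N)) W).
  case: (lcnorm2 _) => [r|_ _|//]; last by rewrite leey.
  rewrite -EFinM -EFinD !lee_fin; lra.
have upper s : uniq s -> (forall n, n \in s -> J n) ->
    (size s)%:R * (plancherel_cst * m / 32) <= 2 * N%:R * M * (2 * W%:R).
  move=> us sJ; rewrite -lee_fin.
  apply: (@le_trans _ _ (\sum_(n <- s) lcnorm2 (trunc (fou (trunc (f n) N)) W))%E).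
    have -> : (size s)%:R * (plancherel_cst * m / 32) = \sum_(n <- s) plancherel_cst * m / 32.
      by rewrite big_const_seq count_predT iter_addr_0 mulr_natl.
    rewrite -sumEFin big_seq [leRHS]big_seq.
    by apply: lee_sum => n ns; exact/lower/sJ.
  under eq_bigr do rewrite cnorm2_trunc_integral//.
  rewrite -ge0_integral_sum//; first last.
  - by move=> n x _; rewrite lee_fin csq_ge0.
  - by move=> n; apply: measurable_funTS; exact: ecsq_measurable (mH n).
  - exact: measurable_window.
  apply: (@le_trans _ _ (\int[leb]_(w in window W) (2 * N%:R * M)%:E)%E).
    apply: ge0_le_integral.
    - exact: measurable_window.
    - by move=> w _; apply: sume_ge0 => n _; rewrite lee_fin csq_ge0.
    - apply: measurable_funTS; apply: emeasurable_sum => n.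
      exact: ecsq_measurable (mH n).
    - exact: measurable_cst.
    move=> w _; rewrite sumEFin lee_fin; apply: truncated_bessel => //.
    by move=> a; exact: HM.
  rewrite integral_cst; last exact: measurable_window.
  rewrite [leRHS]EFinM [leLHS](_ : _ = ((2 * N%:R * M)%:E * (2 * W%:R)%:E)%E)//.
  by congr (_ * _)%E; exact: window_length.
apply: contrapT => infJ.
pose B : R := 2 * N%:R * M * (2 * W%:R) / (plancherel_cst * m / 32).
have [k kB] : exists k : nat, B < k%:R.
  exists (Num.bound `|B|); apply: le_lt_trans (ler_norm B) _.
  by apply: archi_boundP.
have [X XJ Xk] := infinite_set_fset k infJ.
have pm : 0 < plancherel_cst * m / 32 by apply: divr_gt0 (mulr_gt0 p0 m0) _; rewrite ltr0n.
have := upper (finmap.enum_fset X) (finmap.fset_uniq X) XJ.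
rewrite -ler_pdivlMr// -/B => XB.
have : B < B; last by rewrite ltxx.
apply: lt_le_trans kB (le_trans _ XB); by rewrite ler_nat.
Qed.

End umbrella.

Theorem corollary4p5 (R : realType) (phi psi : R -> R[i]) (J : set nat)
    (g : nat -> R -> R[i])
    (hphi : cLfun (@haar R) Rpos 2 phi)
    (hpsi : cLfun (@lebesgue_measure R) setT 2 psi)
    (hg : orthonormal_seq (@haar R) Rpos J g \/ Riesz_seq (@haar R) Rpos J g)
    (hg_phi : forall n, J n ->
       {ae @haar R, forall x, Rpos x -> `|g n x| <= `|phi x|})
    (hg_psi : forall n, J n ->
       {ae @lebesgue_measure R, forall w, `|mellin (g n) w| <= `|psi w|}) :
  finite_set J.
Proof.
have hR : Riesz_seq (@haar R) Rpos J g by case: hg => // /orthonormal_Riesz.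
have [m [M [m0 M0 gm gM]]] := Riesz_seq_bounds measurable_Rpos hR.
have g2 n : J n -> cLfun (@haar R) Rpos 2 (g n) by have [] := hR => /(_ n).
(* Outside J nothing is known of [g n], so it is replaced by 0. *)
pose f n : R -> R[i] := if `[< J n >] then (fun x => g n (expR x)) else (fun=> 0).
have fJ n : J n -> f n = (fun x => g n (expR x)).
  by move=> Jn; rewrite /f; case: asboolP.
apply: (@umbrella_theorem R J f (fun x => phi (expR x)) psi m M) => //.
- move=> n; rewrite /f; case: asboolP => [Jn|_]; last exact: L2_zero.
  exact/cLfun2_haar/g2.
- exact: cLfun2_haar.
- move=> n Jn; rewrite fJ// -cnorm2_haar; first exact: gm.
  by have /cLfun2P[] := g2 n Jn.
- move=> s a us sJ.
  have -> : (fun x => \sum_(n <- s) a n * f n x) =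
      (fun x => (fun y => \sum_(n <- s) a n * g n y) (expR x)).
    by apply/funext => x; apply: eq_big_seq => n /sJ Jn; rewrite fJ.
  rewrite -(@cnorm2_haar R (fun y => \sum_(n <- s) a n * g n y)); first exact: gM.
  have /cLfun2P[//] : cLfun (@haar R) Rpos 2 (fun y => \sum_(n <- s) a n * g n y).
  by apply: L2_sum; [exact: measurable_Rpos|move=> n /sJ; exact: g2].
- move=> n Jn; rewrite fJ//.
  apply: (@ae_haar R (fun x => csq (g n x) <= csq (phi x))).
  by apply: ae_imp (hg_phi n Jn) => x H /H; exact: normr_le_csq.
- move=> n Jn; rewrite fJ//.
  by apply: ae_imp (hg_psi n Jn) => w; exact: normr_le_csq.
Qed.
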